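(* Let $N\geqslant 1$ and $s\geqslant 1$ be integers. For $i=1,\dots,N$ let $n_i\geqslant 1$ be an integer and $w_i>0$ a real number. Let $X_{ij},Z_{ij}$ ($i=1,\dots,N$, $j=1,\dots,n_i$) be mutually independent integer-valued random variables such that, for each $i$, all $X_{ij}$ ($j=1,\dots,n_i$) have the same distribution $F_i$ and all $Z_{ij}$ ($j=1,\dots,n_i$) have the same distribution $G_i$. Put $S=\sum_{i=1}^N w_i\sum_{j=1}^{n_i}X_{ij}$ and $Z=\sum_{i=1}^N w_i\sum_{j=1}^{n_i}Z_{ij}$. Assume that for all $i=1,\dots,N$: $$u_i>0,\qquad n_iu_i\geqslant 1,$$ $$\nu_k^{+}(F_i)=\nu_k^{+}(G_i),\qquad \nu_k^{-}(F_i)=\nu_k^{-}(G_i),\qquad k=1,2,\dots,s,$$ $$\beta_{s+1}^{+}(F_i,G_i)+\beta_{s+1}^{-}(F_i,G_i)<\infty .$$ Then $$\bigl|\mathcal L(S)-\mathcal L(Z)\bigr|_K\leqslant C(N,s)\frac{\max_j w_j}{\min_j w_j}\Bigl(\sum_{i=1}^N n_iu_i\Bigr)^{-1/2}\sum_{i=1}^N\frac{\beta^{+}_{s+1}(F_i,G_i)+\beta^{-}_{s+1}(F_i,G_i)}{n_i^{s/2-1}u_i^{s/2}},$$ where $C(N,s)$ is a positive constant depending only on $N$ and $s$.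
   Context: $\mathcal L(\xi)$ is the distribution of $\xi$. For a finite signed measure $M$ on $\mathbb R$: $|M|_K=\sup_{x\in\mathbb R}|M((-\infty,x])|$ is the Kolmogorov norm, and $\|M\|=M^{+}\{\mathbb R\}+M^{-}\{\mathbb R\}$ is the total variation norm ($M=M^+-M^-$ the Jordan–Hahn decomposition). $I_a$ is the unit mass at $a$ and $I=I_0$; products of measures are convolutions. For a probability distribution $F$ on the integers and $k\geqslant 1$, the right-hand and left-hand factorial moments are $$\nu_k^{+}(F)=\sum_{m=k}^\infty m(m-1)\cdots(m-k+1)F\{m\},\qquad \nu_k^{-}(F)=\sum_{m=k}^\infty m(m-1)\cdots(m-k+1)F\{-m\}.$$ Further, $\beta_k^{\pm}(F,G)=\nu_k^{\pm}(F)+\nu_k^{\pm}(G)$, and $$u_i=\min\Bigl\{1-\tfrac12\|F_i(I_1-I)\|;\ 1-\tfrac12\|G_i(I_1-I)\|\Bigr\}=\min\Bigl\{\sum_{k\in\mathbb Z}\min(F_i\{k\},F_i\{k-1\});\ \sum_{k\in\mathbb Z}\min(G_i\{k\},G_i\{k-1\})\Bigr\}.$$ *)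

(* Defs.v *)
From HB Require Import structures.
From mathcomp Require Import all_boot all_order all_algebra.
From mathcomp Require Import all_classical all_reals all_analysis.
From mathcomp Require Import measurable_realfun.
Set Implicit Arguments.
Unset Strict Implicit.
Unset Printing Implicit Defensive.
Import Order.TTheory GRing.Theory Num.Theory.
Import numFieldNormedType.Exports.
Local Open Scope classical_set_scope.
Local Open Scope ring_scope.

Section SignedMeasures.
Context {R : realType}.
Local Open Scope ereal_scope.

Definition kolmogorov_norm (M : {charge set R -> \bar R}) : \bar R :=
  ereal_sup [set `|M `]-oo, x]%classic| | x in [set: R]].

Definition hahn_sets (M : {charge set R -> \bar R}) :
  {PN : set R * set R | hahn_decomposition M PN.1 PN.2}.
Proof.
apply: cid; have [P [N PN]] := Hahn_decomposition M.
by exists (P, N).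
Qed.

(* The values of the Jordan parts do not depend on the chosen Hahn
   decomposition (Hahn_decomposition_uniq). *)
Definition tv_norm (M : {charge set R -> \bar R}) : \bar R :=
  jordan_pos (svalP (hahn_sets M)) [set: R] +
  jordan_neg (svalP (hahn_sets M)) [set: R].

Definition charge_sub (P Q : probability R R) : {charge set R -> \bar R} :=
  cadd (charge_of_finite_measure P) (copp (charge_of_finite_measure Q)).

Lemma charge_subE (P Q : probability R R) (A : set R) :
  charge_sub P Q A = P A - Q A.
Proof. by []. Qed.

Definition pair_add (z : (R * R)%type) : R := (z.1 + z.2)%R.

Lemma measurable_pair_add : measurable_fun [set: (R * R)%type] pair_add.
Proof. by apply: measurable_funD; [exact: measurable_fst|exact: measurable_snd]. Qed.

HB.instance Definition _ :=
  isMeasurableFun.Build _ _ (R * R)%type R pair_add measurable_pair_add.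

Definition convolution (P Q : probability R R) : probability R R :=
  distribution (P \x Q) pair_add.

Lemma convolution_dirac (P : probability R R) (a : R) (A : set R) :
  measurable A -> convolution P (dirac a) A = P [set x | A (x + a)%R].
Proof.
move=> mA.
rewrite /convolution /distribution /pushforward /product_measure1 /=.
have mB : measurable [set x | A (x + a)%R].
  have mf : measurable_fun [set: R] (fun x : R => x + a)%R.
    exact: measurable_funD.
  by rewrite -[X in measurable X]setTI; exact: mf.
rewrite [LHS](eq_integral (fun x => (\1_[set x | A (x + a)%R] x)%:E)).
  by rewrite integral_indic// setIT.
move=> x _ /=; rewrite diracE indicE; congr (_%:R)%:E.
by congr nat_of_bool; apply/idP/idP; rewrite !inE /xsection/= ?inE.
Qed.

End SignedMeasures.

Section IntegerDistributions.
Context {R : realType}.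
Implicit Types F G : probability R R.

(* A distribution on the integers is a probability on R carried by Z; below,
   F{m} is F [set m%:~R].  The falling factorial m ^_ k is m(m-1)...(m-k+1). *)
Definition nu_plus k F : \bar R :=
  (\sum_(k <= m <oo) (m ^_ k)%:R%:E * F [set m%:R])%E.

Definition nu_minus k F : \bar R :=
  (\sum_(k <= m <oo) (m ^_ k)%:R%:E * F [set (- m%:R)%R])%E.

Definition beta_plus k F G : \bar R := (nu_plus k F + nu_plus k G)%E.

Definition beta_minus k F G : \bar R := (nu_minus k F + nu_minus k G)%E.

(* F (I_1 - I), expanded as F I_1 - F I; I_a is dirac a. *)
Definition shift_diff F : {charge set R -> \bar R} :=
  charge_sub (convolution F (dirac (1 : R))) (convolution F (dirac (0 : R))).

Definition u_of F G : R :=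
  Num.min (1 - 2^-1 * fine (tv_norm (shift_diff F)))
          (1 - 2^-1 * fine (tv_norm (shift_diff G))).

End IntegerDistributions.

Section RandomVariables.
Context {R : realType} {d : measure_display} {T : measurableType d}.
Variable P : probability T R.

Definition integer_valued (X : {RV P >-> R}) := forall t, X t \is a Num.int.

Definition mutually_independent (I : finType) (X : I -> {RV P >-> R}) :=
  forall (J : {set I}) (A : I -> set R), (forall i, measurable (A i)) ->
    P (\bigcap_(i in [set` J]) (X i @^-1` A i)) =
    (\prod_(i in J) P (X i @^-1` A i))%E.

Definition weighted_sum (N : nat) (n : 'I_N -> nat) (w : 'I_N -> R)
    (X : forall i, 'I_(n i) -> {RV P >-> R}) : {RV P >-> R} :=
  (\sum_(i < N) w i *: \sum_(j < n i) (X i j : {mfun T >-> R}))%R.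

Lemma weighted_sumE (N : nat) (n : 'I_N -> nat) (w : 'I_N -> R)
    (X : forall i, 'I_(n i) -> {RV P >-> R}) t :
  weighted_sum w X t = \sum_(i < N) w i * \sum_(j < n i) X i j t.
Proof.
have mfun_sum (I : finType) (f : I -> {mfun T >-> R}) s :
    (\sum_(i : I) f i) s = \sum_(i : I) f i s.
  by elim/big_rec2 : _ => // i y z _ <-.
rewrite /weighted_sum mfun_sum; apply: eq_bigr => i _.
by rewrite -mfun_sum.
Qed.

(* Both families together, so that independence is asserted jointly. *)
Definition joint_family (N : nat) (n : 'I_N -> nat)
    (X Z : forall i, 'I_(n i) -> {RV P >-> R})
    (k : {i : 'I_N & 'I_(n i)} + {i : 'I_N & 'I_(n i)}) : {RV P >-> R} :=
  match k with
  | inl p => X (tag p) (tagged p)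
  | inr p => Z (tag p) (tagged p)
  end.

End RandomVariables.

(* Since the weights are positive, 0 is a neutral starting value for the
   maximum, and the maximum is one for the minimum. *)
Definition max_weight {R : realType} (N : nat) (w : 'I_N -> R) : R :=
  \big[Num.max/0]_(j < N) w j.

Definition min_weight {R : realType} (N : nat) (w : 'I_N -> R) : R :=
  \big[Num.min/max_weight w]_(j < N) w j.

(* Main.v *)
Require Import Defs.
From HB Require Import structures.
From mathcomp Require Import all_boot all_order all_algebra.
From mathcomp Require Import all_classical all_reals all_analysis.
From mathcomp Require Import ring lra zify.
Import Order.TTheory GRing.Theory Num.Theory.
Import numFieldNormedType.Exports.
Local Open Scope classical_set_scope.
Local Open Scope ring_scope.
Set Implicit Arguments.
Unset Strict Implicit.
Unset Printing Implicit Defensive.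

(* Truncating all variables to [-K, K] turns each F_i, G_i into the coefficients
   of polynomials p_i, q_i, and P(S <= x) into the value of prod_i p_i(T_i)^n_i at
   the indicator of a half-line, where T_i is the shift by w_i; K tends to
   infinity at the end.

   Exchange the p_i^n_i for q_i^n_i one index at a time.  Taylor expansion at 1
   and the matching of the factorial moments give p_i - q_i = E + (X - 1)^(s+1) V
   with |V|_1 <= beta_(s+1) and |E|_1 -> 0, and
   p^n - q^n = (p - q) sum_k p^(n-1-k) q^k, where one of the two exponents is at
   least (n - 1) / 2.  Each of s factors X - 1 is absorbed by a share of about
   n / (2 s + 2) copies of that law, which costs O((n u)^(-1/2)) in the l1-norm.

   The last factor X - 1, the shift by w_i, is compared with shifts by w_j, for
   the index j with n_j u_j largest: the action of p_j^n_j on a decreasing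
   function is decreasing, so a shift by w_i changes it by at most w_i / w_j + 1
   times what a shift by w_j does.  This yields the factor
   (max w / min w) (sum_i n_i u_i)^(-1/2). *)

(** * The l1-norm of the coefficients of a polynomial *)

Section L1Norm.
Context {R : rcfType}.
Implicit Types (p q : {poly R}).

Definition l1 p : R := \sum_(j < size p) `|p`_j|.

Lemma l1_widen p n : (size p <= n)%N -> l1 p = \sum_(j < n) `|p`_j|.
Proof.
move=> pn; rewrite /l1 (big_ord_widen_cond n predT (fun j => `|p`_j|))//.
rewrite [RHS](bigID (fun i : 'I_n => (i < size p)%N))/= [X in _ = _ + X]big1 ?addr0//.
by move=> i; rewrite -leqNgt => ?; rewrite nth_default ?normr0.
Qed.

Lemma l1_ge0 p : 0 <= l1 p.
Proof. exact: sumr_ge0. Qed.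

Lemma l10 : l1 0 = 0.
Proof. by rewrite /l1 size_poly0 big_ord0. Qed.

Lemma l1_MXaddC p c : l1 (p * 'X + c%:P) = l1 p + `|c|.
Proof.
rewrite (@l1_widen _ (size p).+1); last first.
  by rewrite size_MXaddC; case: ifP.
rewrite big_ord_recl addrC; congr (_ + _).
  by apply: eq_bigr => i _; rewrite coefD coefMX coefC /= addr0.
by rewrite coefD coefMX coefC add0r.
Qed.

Lemma l1C c : l1 c%:P = `|c|.
Proof. by rewrite -[c%:P]add0r -(mul0r 'X) l1_MXaddC l10 add0r. Qed.

Lemma l1_1 : l1 1 = 1.
Proof. by rewrite -[1]/(1%:P) l1C normr1. Qed.

Lemma l1MX p : l1 (p * 'X) = l1 p.
Proof. by rewrite -[p * 'X]addr0 -[0]/(0%:P) l1_MXaddC normr0 addr0. Qed.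

Lemma l1Z c p : l1 (c *: p) = `|c| * l1 p.
Proof.
rewrite (@l1_widen _ (size p)) ?size_scale_leq// mulr_sumr.
by apply: eq_bigr => i _; rewrite coefZ normrM.
Qed.

Lemma l1N p : l1 (- p) = l1 p.
Proof. by rewrite -scaleN1r l1Z normrN1 mul1r. Qed.

Lemma l1D p q : l1 (p + q) <= l1 p + l1 q.
Proof.
have pm : (size p <= maxn (size p) (size q))%N by rewrite leq_maxl.
have qm : (size q <= maxn (size p) (size q))%N by rewrite leq_maxr.
rewrite (l1_widen pm) (l1_widen qm) (l1_widen (size_polyD _ _)) -big_split/=.
by apply: ler_sum => i _; rewrite coefD ler_normD.
Qed.

Lemma l1B p q : l1 (p - q) <= l1 p + l1 q.
Proof. by rewrite -[l1 q]l1N l1D. Qed.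

Lemma l1_sum (I : Type) (r : seq I) (P : pred I) (f : I -> {poly R}) :
  l1 (\sum_(i <- r | P i) f i) <= \sum_(i <- r | P i) l1 (f i).
Proof.
elim/big_rec2 : _ => [|i y z _ h]; first by rewrite l10.
by rewrite (le_trans (l1D _ _))// lerD2l.
Qed.

Lemma l1M p q : l1 (p * q) <= l1 p * l1 q.
Proof.
elim/poly_ind : p => [|p c ih]; first by rewrite mul0r l10 mul0r.
rewrite l1_MXaddC !mulrDl -mulrA ['X * q]mulrC mulrA (le_trans (l1D _ _))//.
by rewrite l1MX lerD// mul_polyC l1Z.
Qed.

Lemma l1X p n : l1 (p ^+ n) <= l1 p ^+ n.
Proof.
elim: n => [|n ih]; first by rewrite !expr0 l1_1.
by rewrite !exprS (le_trans (l1M _ _))// ler_wpM2l ?l1_ge0.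
Qed.

Lemma l1M_le p q a b : l1 p <= a -> l1 q <= b -> l1 (p * q) <= a * b.
Proof. by move=> pa qb; rewrite (le_trans (l1M _ _))// ler_pM ?l1_ge0. Qed.

Lemma l1X_le1 p n : l1 p <= 1 -> l1 (p ^+ n) <= 1.
Proof. by move=> p1; rewrite (le_trans (l1X _ _))// exprn_ile1 ?l1_ge0. Qed.

Lemma l1Xn n : l1 'X^n = 1.
Proof. by elim: n => [|n ih]; rewrite ?expr0 ?l1_1// exprSr l1MX. Qed.

(** This makes the norm additive and multiplicative among polynomials with nonnegative
    coefficients. *)
Lemma l1_horner1 p : (forall j, 0 <= p`_j) -> l1 p = p.[1].
Proof.
move=> p0; rewrite horner_coef; apply: eq_bigr => i _.
by rewrite expr1n mulr1 ger0_norm.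
Qed.

Lemma l1_Xsub1 : l1 ('X - 1 : {poly R}) <= 2.
Proof. by rewrite (le_trans (l1B _ _))// -{1}['X]expr1 l1Xn l1_1. Qed.

Lemma coef_poly_ge0M p q : (forall j, 0 <= p`_j) -> (forall j, 0 <= q`_j) ->
  forall j, 0 <= (p * q)`_j.
Proof. by move=> p0 q0 j; rewrite coefM sumr_ge0// => i _; rewrite mulr_ge0. Qed.

End L1Norm.

(** * Polynomials acting on functions through translations *)

Section Action.
Context {R : rcfType}.
Implicit Types (p q : {poly R}) (h g : R -> R) (w y : R).

(* The signed measure with mass p`_j at w * j, integrated against h (y + _). *)
Definition act w p h : R -> R :=
  fun y => \sum_(j < size p) p`_j * h (y + w * j%:R).

Lemma act_widen w p h y n : (size p <= n)%N ->
  act w p h y = \sum_(j < n) p`_j * h (y + w * j%:R).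
Proof.
move=> pn; rewrite /act (big_ord_widen_cond n predT (fun j => p`_j * h (y + w * j%:R)))//.
rewrite [RHS](bigID (fun i : 'I_n => (i < size p)%N))/= [X in _ = _ + X]big1 ?addr0//.
by move=> i; rewrite -leqNgt => ?; rewrite nth_default ?mul0r.
Qed.

Lemma act0 w h y : act w 0 h y = 0.
Proof. by rewrite /act size_poly0 big_ord0. Qed.

Lemma act_MXaddC w p (c : R) h y :
  act w (p * 'X + c%:P) h y = act w p h (y + w) + c * h y.
Proof.
rewrite (@act_widen _ _ _ _ (size p).+1); last first.
  by rewrite size_MXaddC; case: ifP.
rewrite big_ord_recl addrC; congr (_ + _).
  apply: eq_bigr => i _; rewrite coefD coefMX coefC /= addr0; congr (_ * h _).
  by rewrite /= /bump /= natrD; ring.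
by rewrite coefD coefMX coefC add0r mulr0 addr0.
Qed.

Lemma actC w (c : R) h y : act w c%:P h y = c * h y.
Proof. by rewrite -[c%:P]add0r -(mul0r 'X) act_MXaddC act0 add0r. Qed.

Lemma act1 w h : act w 1 h = h.
Proof. by apply/funext => y; rewrite -[1]/(1%:P) actC mul1r. Qed.

Lemma actD w p q h y : act w (p + q) h y = act w p h y + act w q h y.
Proof.
have pm : (size p <= maxn (size p) (size q))%N by rewrite leq_maxl.
have qm : (size q <= maxn (size p) (size q))%N by rewrite leq_maxr.
rewrite (act_widen _ _ _ pm) (act_widen _ _ _ qm) (act_widen _ _ _ (size_polyD _ _)).
by rewrite -big_split/=; apply: eq_bigr => i _; rewrite coefD mulrDl.
Qed.

Lemma actZ w a p h y : act w (a *: p) h y = a * act w p h y.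
Proof.
rewrite (@act_widen _ _ _ _ (size p)) ?size_scale_leq// mulr_sumr.
by apply: eq_bigr => i _; rewrite coefZ mulrA.
Qed.

Lemma actB w p q h y : act w (p - q) h y = act w p h y - act w q h y.
Proof. by rewrite actD -scaleN1r actZ mulN1r. Qed.

Lemma act_sum w (I : Type) (r : seq I) (f : I -> {poly R}) h y :
  act w (\sum_(i <- r) f i) h y = \sum_(i <- r) act w (f i) h y.
Proof. by elim/big_rec2 : _ => [|i a b _ <-]; rewrite ?act0 ?actD. Qed.

(** Multiplying by X amounts to translating by [w], so Horner's scheme reduces products to this
    single case. *)
Lemma actM w p q h : act w (p * q) h = act w p (act w q h).
Proof.
elim/poly_ind : p => [|p c ih]; apply/funext => y; first by rewrite mul0r !act0.
rewrite act_MXaddC -ih mulrDl actD mul_polyC actZ; congr (_ + _).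
by rewrite -mulrA ['X * q]mulrC mulrA -[p * q * 'X]addr0 -[0]/(0%:P)
  act_MXaddC mul0r addr0.
Qed.

(** Translations of the line commute, even with different step sizes. *)
Lemma act_comm w w' p q h : act w p (act w' q h) = act w' q (act w p h).
Proof.
apply/funext => y; rewrite /act.
under eq_bigr do rewrite mulr_sumr.
rewrite exchange_big/=; apply: eq_bigr => i _; rewrite mulr_sumr.
apply: eq_bigr => j _; rewrite mulrCA; congr (_ * (_ * h _)).
by rewrite addrAC.
Qed.

Lemma act_le w p h (c : R) : (forall y, `|h y| <= c) ->
  forall y, `|act w p h y| <= l1 p * c.
Proof.
move=> hc y; rewrite (le_trans (ler_norm_sum _ _ _))// /l1 mulr_suml.
by apply: ler_sum => i _; rewrite normrM ler_wpM2l.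
Qed.

Lemma act_le1 w p h (c : R) : 0 <= c -> l1 p <= 1 -> (forall y, `|h y| <= c) ->
  forall y, `|act w p h y| <= c.
Proof.
move=> c0 p1 hc y; rewrite (le_trans (act_le _ _ hc _))//.
by rewrite -[leRHS]mul1r ler_wpM2r.
Qed.

Lemma act_Xsub1 w h y : act w ('X - 1) h y = h (y + w) - h y.
Proof.
by rewrite -[- 1]/(- 1%:P) -polyCN -['X]mul1r act_MXaddC act1 mulN1r.
Qed.

Lemma act_decr w p h : 0 <= w -> (forall j, 0 <= p`_j) ->
  {homo h : x y /~ x <= y} -> {homo act w p h : x y /~ x <= y}.
Proof.
move=> w0 p0 hh x y xy; apply: ler_sum => i _.
by rewrite ler_wpM2l// hh// lerD2r.
Qed.

(** When [h] is the indicator of a half-line, this is the distribution function of a sum of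
    independent lattice variables, one for each pair of a weight and a law. *)
Definition acts (c : seq (R * {poly R})) h : R -> R :=
  foldr (fun wp g => act wp.1 wp.2 g) h c.

Lemma acts_cat (c1 c2 : seq (R * {poly R})) h : acts (c1 ++ c2) h = acts c1 (acts c2 h).
Proof. by rewrite /acts foldr_cat. Qed.

Lemma acts_nseq n w p h : acts (nseq n (w, p)) h = act w (p ^+ n) h.
Proof.
by elim: n => [|n ih]; rewrite ?expr0 ?act1//= ih exprS actM.
Qed.

Lemma acts_le (c : seq (R * {poly R})) h (a : R) : 0 <= a -> (forall x, x \in c -> l1 x.2 <= 1) ->
  (forall y, `|h y| <= a) -> forall y, `|acts c h y| <= a.
Proof.
move=> a0; elim: c => //= x c ih c1 ha y; apply: act_le1 => //.
  by apply: c1; rewrite mem_head.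
by apply: ih => // z zc; apply: c1; rewrite inE zc orbT.
Qed.

(** Since the factors commute, any chosen law can be brought to the front. *)
Lemma acts_perm (c1 c2 : seq (R * {poly R})) h : perm_eq c1 c2 -> acts c1 h = acts c2 h.
Proof.
elim: c1 c2 => [|x c1 ih] c2 => [|pc].
  by rewrite perm_sym => /perm_nilP ->.
have xc2 : x \in c2 by rewrite -(perm_mem pc) mem_head.
have : perm_eq c1 (rem x c2).
  by rewrite -(perm_cons x) (perm_trans pc)// perm_to_rem.
move=> /ih e /=; rewrite e.
(* It remains to carry [x] past the entries that precede it in [c2], one commutation at a time. *)
elim: c2 xc2 {pc e} => //= z c2 ih2; rewrite inE eq_sym.
case: eqP => [-> //|_ /= /ih2 <-].
by rewrite act_comm.
Qed.

End Action.

(** * Smoothing: the factor X - 1 against powers of a law *)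

Section Smoothing.
Context {R : rcfType}.
Implicit Types (p : {poly R}).

Lemma coef_euler_sub (c : R) p j :
  (2 *: ('X * p^`()) - c *: p)`_j = (2 * j%:R - c) * p`_j.
Proof.
rewrite coefB !coefZ coefXM coef_deriv mulrBl; congr (_ - _).
case: j => [|j]; first by rewrite !(mulr0, mul0r).
by rewrite /= -mulr_natl; ring.
Qed.

(* [2 X D - n] multiplies the j-th coefficient by 2j - n, and maps (1 + X)^n to
   n (X - 1) (1 + X)^(n-1). *)
Lemma coef_Xsub1_binomial n j :
  (n.+1%:R *: (('X - 1) * (1 + 'X) ^+ n) : {poly R})`_j =
  (2 * j%:R - n.+1%:R) * ((1 + 'X) ^+ n.+1)`_j.
Proof.
have -> : n.+1%:R *: (('X - 1) * (1 + 'X) ^+ n) =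
    2 *: ('X * ((1 + 'X) ^+ n.+1)^`()) - n.+1%:R *: (1 + 'X) ^+ n.+1 :> {poly R}.
  rewrite deriv_exp derivD -polyC1 derivC derivX add0r mul1r /= !scaler_nat.
  by rewrite exprS; ring.
by rewrite coef_euler_sub.
Qed.

Lemma size_binomial n : (size ((1 + 'X) ^+ n : {poly R}) <= n.+1)%N.
Proof.
have := size_poly_exp_leq (1 + 'X : {poly R}) n.
by rewrite addrC -polyC1 size_XaddC mul1n.
Qed.

(** Up to the factor 2^(n+1), this is the variance of a sum of n + 1 random signs. The operator 2 X
    D - (n + 1), applied twice to (1 + X)^(n+1), produces the summands as coefficients; evaluate at
    1. *)
Lemma binomial_second_moment n :
  \sum_(j < n.+2) (2 * j%:R - n.+1%:R) ^+ 2 * ((1 + 'X : {poly R}) ^+ n.+1)`_j =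
  n.+1%:R * 2 ^+ n.+1.
Proof.
pose L : {poly R} := n.+1%:R *: (('X - 1) * (1 + 'X) ^+ n).
pose q := 2 *: ('X * L^`()) - n.+1%:R *: L.
have cq j : q`_j = (2 * j%:R - n.+1%:R) ^+ 2 * ((1 + 'X : {poly R}) ^+ n.+1)`_j.
  by rewrite coef_euler_sub expr2 -mulrA -coef_Xsub1_binomial.
have sq : (size q <= n.+2)%N.
  apply/leq_sizeP => j nj; rewrite cq nth_default ?mulr0//.
  by rewrite (leq_trans (size_binomial _)).
have <- : q.[1] = n.+1%:R * 2 ^+ n.+1.
  rewrite /q /L derivZ derivM derivB derivX -polyC1 derivC !hornerE /=.
  by rewrite exprS; ring.
rewrite (horner_coef_wide _ sq); apply: eq_bigr => j _.
by rewrite expr1n mulr1 cq.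
Qed.

Lemma coef_binomial_ge0 n j : 0 <= ((1 + 'X : {poly R}) ^+ n)`_j.
Proof.
elim: n j => [|n ih] j; first by rewrite expr0 coef1.
by rewrite exprS mulrDl mul1r coefD coefXM; case: j => [|j]; rewrite ?addr0 ?addr_ge0.
Qed.

(** Expand (|x| - t)^2 / t >= 0. Summed with a well-chosen [t], it does the work of the
    Cauchy-Schwarz inequality. *)
Lemma ler_norm_AMGM (x t : R) : 0 < t -> `|x| <= 2^-1 * (x ^+ 2 / t + t).
Proof.
move=> t0; rewrite -[x ^+ 2]real_normK ?num_real//.
have : 0 <= (`|x| - t) ^+ 2 / t by rewrite divr_ge0 ?sqr_ge0 ?ltW.
have -> : (`|x| - t) ^+ 2 / t = `|x| ^+ 2 / t + t - 2 * `|x|.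
  by field; rewrite gt_eqF.
lra.
Qed.

(** By [coef_Xsub1_binomial], n + 1 times the norm equals 2^(n+1) times the mean absolute value of a
    sum of n + 1 random signs, and the second moment bounds that mean by sqrt (n + 1). *)
Lemma l1_Xsub1_binomial n :
  l1 (('X - 1) * (1 + 'X) ^+ n : {poly R}) <= 2 ^+ n.+1 / Num.sqrt n.+1%:R.
Proof.
set t := Num.sqrt n.+1%:R.
have t0 : 0 < t by rewrite sqrtr_gt0.
have tE : t ^+ 2 = n.+1%:R by rewrite sqr_sqrtr.
rewrite -(ler_pM2l (_ : 0 < n.+1%:R :> R))// -[X in X * l1 _]ger0_norm// -l1Z.
set q := _ *: _.
have sq : (size q <= n.+2)%N.
  apply/leq_sizeP => j nj; rewrite coef_Xsub1_binomial nth_default ?mulr0//.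
  by rewrite (leq_trans (size_binomial _)).
rewrite (l1_widen sq) (le_trans (y := \sum_(j < n.+2)
    (2^-1 * ((2 * j%:R - n.+1%:R) ^+ 2 * ((1 + 'X : {poly R}) ^+ n.+1)`_j) / t +
     2^-1 * t * (((1 + 'X : {poly R}) ^+ n.+1)`_j)))) //.
  apply: ler_sum => j _; rewrite coef_Xsub1_binomial normrM.
  rewrite [X in _ * X]ger0_norm ?coef_binomial_ge0//.
  have := ler_wpM2r (coef_binomial_ge0 n.+1 j) (ler_norm_AMGM (2 * j%:R - n.+1%:R) t0).
  move=> /le_trans; apply; rewrite le_eqVlt; apply/orP; left; apply/eqP.
  by ring.
rewrite big_split/= -mulr_suml -!mulr_sumr binomial_second_moment.
have -> : \sum_(j < n.+2) ((1 + 'X : {poly R}) ^+ n.+1)`_j = 2 ^+ n.+1.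
  transitivity (((1 + 'X : {poly R}) ^+ n.+1).[1]).
    rewrite (horner_coef_wide _ (size_binomial n.+1)).
    by apply: eq_bigr => i _; rewrite expr1n mulr1.
  by rewrite !hornerE.
rewrite -tE le_eqVlt; apply/orP; left; apply/eqP.
by field; rewrite gt_eqF.
Qed.

(* 1 - ||F (I_1 - I)|| / 2 for the law F with mass p`_j at j. *)
Definition overlap p : R := \sum_(j < size p) Num.min p`_j p`_j.+1.

Lemma overlap_widen p n : (size p <= n)%N ->
  overlap p = \sum_(j < n) Num.min p`_j p`_j.+1.
Proof.
move=> pn; rewrite /overlap (big_ord_widen_cond n predT (fun j => Num.min p`_j p`_j.+1))//.
rewrite [RHS](bigID (fun i : 'I_n => (i < size p)%N))/= [X in _ = _ + X]big1 ?addr0//.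
by move=> i; rewrite -leqNgt => ?; rewrite !nth_default ?minxx// leqW.
Qed.

(** Let [M] have coefficients min(p_j, p_(j+1)). Then M_j and M_(j-1) are both at most p_j, hence so
    is their half-sum, the j-th coefficient of (1 + X) M / 2. The rest [B] is therefore nonnegative,
    and norms can be read off at 1. *)
Lemma overlap_decomposition p : (forall j, 0 <= p`_j) ->
  exists M B : {poly R}, [/\ p = (2^-1 *: (1 + 'X)) * M + B,
    l1 M = overlap p & l1 B = l1 p - overlap p].
Proof.
move=> p0; pose M := \poly_(j < size p) Num.min p`_j p`_j.+1.
have cM j : M`_j = Num.min p`_j p`_j.+1.
  rewrite coef_poly; case: ltnP => // pj.
  by rewrite !nth_default ?minxx// leqW.
have M0 j : 0 <= M`_j by rewrite cM le_min !p0.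
pose B := p - (2^-1 *: (1 + 'X)) * M.
have B0 j : 0 <= B`_j.
  rewrite coefB -scalerAl coefZ mulrDl mul1r coefD coefXM.
  have h1 : M`_j <= p`_j by rewrite cM ge_min lexx.
  case: j h1 => [|j] h1 /=; first by have := p0 0%N; have := M0 0%N; lra.
  have h2 : M`_j <= p`_j.+1 by rewrite cM ge_min lexx orbT.
  lra.
have lM : l1 M = overlap p.
  rewrite (@l1_widen _ _ (size p)) ?size_poly//.
  by apply: eq_bigr => i _; rewrite ger0_norm// cM.
exists M, B; split => //; first by rewrite /B addrC subrK.
rewrite l1_horner1// /B hornerD hornerN hornerM -lM !l1_horner1// !hornerE.
by congr (_ - _); rewrite -[RHS]mul1r; congr (_ * _); field.
Qed.

(** Since (m + 1) C(m, i) = (i + 1) C(m + 1, i + 1), multiplying the sum by (m + 1) x gives the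
    expansion of (t + x)^(m+1) without its first term. *)
Lemma binomial_inverse_moment m (x t : R) : 0 <= t -> 0 < x -> t + x <= 1 ->
  \sum_(i < m.+1) (t ^+ (m - i) * x ^+ i) *+ 'C(m, i) / i.+1%:R <= (m.+1%:R * x)^-1.
Proof.
move=> t0 x0 tx.
have mx : 0 < m.+1%:R * x by rewrite mulr_gt0.
rewrite -[leRHS]mul1r ler_pdivlMr// mulrC mulr_sumr.
rewrite (@le_trans _ _ ((t + x) ^+ m.+1))//; last by rewrite exprn_ile1// addr_ge0// ltW.
rewrite exprDn [leRHS]big_ord_recl/= -[leLHS]add0r lerD//.
  by rewrite mulrn_wge0// mulr_ge0// exprn_ge0// ltW.
apply: ler_sum => i _; rewrite /bump /= add1n subSS exprS le_eqVlt.
apply/orP; left; apply/eqP.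
have e : m.+1%:R * 'C(m, i)%:R = i.+1%:R * 'C(m.+1, i.+1)%:R :> R.
  by rewrite -!natrM -mul_bin_diag.
rewrite -[_ *+ 'C(m, i)]mulr_natr -[_ *+ 'C(m.+1, i.+1)]mulr_natr.
have : i.+1%:R != 0 :> R by rewrite pnatr_eq0.
move: e; move: (m.+1%:R : R) ('C(m, i)%:R : R) (i.+1%:R : R) ('C(m.+1, i.+1)%:R : R).
move: (t ^+ _) (x ^+ i) => A B a b c f e c0.
have -> : a * x * (A * B * b / c) = (a * b) * (A * B * x / c) by ring.
by rewrite e; field.
Qed.

(* Conditionally on the number k of steps that use the overlap, the law contains
   the binomial factor ((1 + X) / 2)^k; then average 1 / sqrt (k + 1). *)
Lemma l1_smoothing p m v : (forall j, 0 <= p`_j) -> l1 p <= 1 ->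
  0 < v -> v <= overlap p ->
  l1 (('X - 1) * p ^+ m) <= 2 / Num.sqrt (m.+1%:R * v).
Proof.
move=> p0 p1 v0 vp; set x := overlap p.
have x0 : 0 < x by exact: lt_le_trans v0 vp.
have [M [B [pE lM lB]]] := overlap_decomposition p0.
set t := l1 B.
have tx : t + x <= 1 by rewrite /t lB subrK.
set th := Num.sqrt (m.+1%:R * x).
have th0 : 0 < th by rewrite sqrtr_gt0 mulr_gt0.
have thE : th ^+ 2 = m.+1%:R * x by rewrite sqr_sqrtr// mulr_ge0// ltW.
rewrite (@le_trans _ _ (2 / th))//; last first.
  rewrite ler_pM2l// lef_pV2 ?posrE// ?sqrtr_gt0 ?mulr_gt0//.
  by rewrite ler_wsqrtr// ler_wpM2l.
have key : l1 (('X - 1) * p ^+ m) <=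
    \sum_(i < m.+1) (t ^+ (m - i) * x ^+ i) *+ 'C(m, i) * (2 / Num.sqrt i.+1%:R).
  have {1}-> : p = B + 2^-1 *: (1 + 'X) * M by rewrite addrC.
  rewrite exprDn mulr_sumr (le_trans (l1_sum _ _ _))//.
  apply: ler_sum => i _.
  have -> : ('X - 1) * (B ^+ (m - i) * (2^-1 *: (1 + 'X) * M) ^+ i *+ 'C(m, i)) =
      ('C(m, i)%:R * 2^-1 ^+ i) *:
      ((B ^+ (m - i) * M ^+ i) * (('X - 1) * (1 + 'X) ^+ i)).
    rewrite exprMn exprZn -mulr_natl -scaler_nat -scalerA -mul_polyC.
    by rewrite -!mul_polyC polyC_natr; ring.
  have c0 : 0 <= 'C(m, i)%:R * 2^-1 ^+ i :> R by rewrite mulr_ge0// exprn_ge0// invr_ge0.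
  have := @l1M_le _ _ _ _ _ (l1M_le (l1X B (m - i)) (l1X M i)) (l1_Xsub1_binomial i).
  rewrite lM -/x -/t => h; rewrite l1Z ger0_norm//.
  rewrite (le_trans (ler_wpM2l c0 h))// -[_ *+ 'C(m, i)]mulr_natl exprVn [2 ^+ i.+1]exprS.
  have : 2 ^+ i != 0 :> R by rewrite expf_neq0// pnatr_eq0.
  move: (2 ^+ i : R) => a a0; rewrite le_eqVlt; apply/orP; left; apply/eqP.
  by field; rewrite a0 sqrtr_eq0 -ltNge ltr0n.
(* The parameter 1 / [th] balances the two terms: after averaging, th / (i + 1) contributes at most
   1 / th by [binomial_inverse_moment], and the constant term at most 1 / th because the weights sum
   to at most 1. *)
have AMGM i : 2 / Num.sqrt i.+1%:R <= th / i.+1%:R + th^-1 :> R.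
  have s0 : 0 < (Num.sqrt i.+1%:R)^-1 :> R by rewrite invr_gt0 sqrtr_gt0.
  have := @ler_norm_AMGM (Num.sqrt i.+1%:R)^-1 th^-1.
  rewrite invr_gt0 => /(_ th0); rewrite (ger0_norm (ltW s0)) exprVn sqr_sqrtr// invrK [_ * th]mulrC.
  by move: (th / _) (_^-1) (th^-1) => a b c; lra.
have bin1 : \sum_(i < m.+1) (t ^+ (m - i) * x ^+ i) *+ 'C(m, i) <= 1.
  rewrite -exprDn exprn_ile1// addr_ge0 ?l1_ge0// ltW//.
have inv1 := binomial_inverse_moment m (l1_ge0 B) x0 tx.
rewrite (le_trans key)// (le_trans (y := \sum_(i < m.+1)
  (th * ((t ^+ (m - i) * x ^+ i) *+ 'C(m, i) / i.+1%:R) +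
   th^-1 * ((t ^+ (m - i) * x ^+ i) *+ 'C(m, i)))))//.
  apply: ler_sum => i _.
  have c0 : 0 <= (t ^+ (m - i) * x ^+ i) *+ 'C(m, i).
    by rewrite mulrn_wge0// mulr_ge0// exprn_ge0 ?l1_ge0// ltW.
  rewrite (le_trans (ler_wpM2l c0 (AMGM i)))//.
  by rewrite mulrDr [_ / th]mulrC mulrCA mulrA lexx.
rewrite big_split/= -!mulr_sumr.
have := ler_wpM2l (ltW th0) inv1.
have th1 : 0 <= th^-1 by rewrite invr_ge0 ltW.
have := ler_wpM2l th1 bin1.
have -> : th * (m.+1%:R * x)^-1 = th^-1.
  by rewrite -thE; field; rewrite gt_eqF.
rewrite mulr1; lra.
Qed.

End Smoothing.

(** * Taylor expansion of powers in a commutative ring *)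

Section TaylorRemainder.

(** Unfolded, this is the sum over j < m of C(j, s) x^(m-1-j) y^(j-s), where terms with j < s
    vanish. The form is free of division and so makes sense for polynomials. *)
Fixpoint taylor_rem {A : comNzRingType} (s m : nat) (x y : A) : A :=
  if m is m'.+1 then x * taylor_rem s m' x y + y ^+ (m' - s) *+ 'C(m', s) else 0.

(** Induction on [m]: multiply the expansion by x = y + (x - y) and regroup by Pascal's rule. The
    one term pushed to order s + 1 joins the remainder. *)
Lemma taylor_exprn (A : comNzRingType) (s m : nat) (x y : A) :
  x ^+ m = \sum_(k < s.+1) (y ^+ (m - k) * (x - y) ^+ k) *+ 'C(m, k) +
           (x - y) ^+ s.+1 * taylor_rem s m x y.
Proof.
elim: m => [|m ih].
  rewrite big_ord_recl big1 /= ?mulr0 ?addr0 ?subn0 ?bin0 ?expr0 ?mulr1//.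
pose f k := (y ^+ (m - k) * (x - y) ^+ k.+1) *+ 'C(m, k).
(* For k > m the truncated subtractions do not differ by one, but then the binomial coefficient is
   0. *)
have xyS k : (y ^+ (m.+1 - k) * (x - y) ^+ k) *+ 'C(m, k) =
             y * (y ^+ (m - k) * (x - y) ^+ k *+ 'C(m, k)).
  have [km|mk] := leqP k m; first by rewrite subSn// exprS -mulrA mulrnAr.
  by rewrite bin_small// !mulr0n mulr0.
have -> : \sum_(k < s.+1) y ^+ (m.+1 - k) * (x - y) ^+ k *+ 'C(m.+1, k) =
    y * (\sum_(k < s.+1) y ^+ (m - k) * (x - y) ^+ k *+ 'C(m, k)) + \sum_(k < s) f k.
  rewrite mulr_sumr; under [in RHS]eq_bigr do rewrite -xyS.
  rewrite !big_ord_recl/= !bin0 -addrA; congr (_ + _); rewrite -big_split/=.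
  by apply: eq_bigr => k _; rewrite /bump /= add1n binS mulrnDr subSS.
rewrite [in LHS]exprS {1}ih /=.
have -> : (x - y) ^+ s.+1 * (x * taylor_rem s m x y + y ^+ (m - s) *+ 'C(m, s)) =
    f s + x * ((x - y) ^+ s.+1 * taylor_rem s m x y).
  by rewrite /f mulrDr mulrnAr [y ^+ _ * _]mulrC mulrCA addrC.
rewrite mulrDr addrA; congr (_ + _).
rewrite -[RHS]addrA; set t := \sum_(i < _) _.
have -> : \sum_(k < s) f k + f s = (x - y) * t.
  rewrite -[LHS](big_ord_recr s (fun k => f k))/= mulr_sumr.
  by apply: eq_bigr => k _; rewrite /f exprS mulrCA mulrnAr.
by rewrite -mulrDl addrC subrK.
Qed.

(** Each step of the recursion adds at most C(m, s), and by Pascal's rule these add up to C(m, s +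
    1). *)
Lemma l1_taylor_rem (R : rcfType) (s m : nat) (x y : {poly R}) :
  l1 x <= 1 -> l1 y <= 1 -> l1 (taylor_rem s m x y) <= 'C(m, s.+1)%:R.
Proof.
move=> x1 y1; elim: m => [|m ih] /=; first by rewrite l10.
rewrite binS natrD (le_trans (l1D _ _))// lerD//.
  by rewrite -[leRHS]mul1r l1M_le.
rewrite -scaler_nat l1Z ger0_norm// -[leRHS]mulr1 ler_wpM2l//.
by rewrite l1X_le1.
Qed.

End TaylorRemainder.

(** * Masses on [-K, K] as coefficients of a polynomial *)

Section LatticePoly.
Context {R : rcfType}.
Implicit Types (c : int -> R) (K : nat).

(** Indices are offset by [K] so that negative integers also receive a coefficient; there are 2K + 1
    of them. *)
Definition lattice_poly K c : {poly R} := \poly_(j < K + K.+1) c (j%:Z - K%:Z).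

Lemma big_lattice_split (V : zmodType) K (f : int -> V) :
  \sum_(j < K + K.+1) f (j%:Z - K%:Z) =
  \sum_(m < K.+1) f m%:Z + \sum_(m < K) f (- m.+1%:Z).
Proof.
rewrite big_split_ord [RHS]addrC /=; congr (_ + _).
  rewrite (reindex_inj rev_ord_inj)/=; apply: eq_bigr => i _; congr f.
  by rewrite -subzn//; ring.
by apply: eq_bigr => i _; rewrite PoszD addrAC subrr add0r.
Qed.

Lemma lattice_polyE K c : lattice_poly K c =
  \sum_(m < K.+1) c m%:Z *: 'X^(K + m) + \sum_(m < K) c (- m.+1%:Z) *: 'X^(K - m.+1).
Proof.
rewrite /lattice_poly poly_def.
pose f (z : int) : {poly R} := c z *: 'X^(absz (z + K%:Z)).
rewrite (eq_bigr (fun j : 'I_(K + K.+1) => f (j%:Z - K%:Z))); last first.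
  by move=> j _; rewrite /f subrK.
rewrite big_lattice_split; congr (_ + _); apply: eq_bigr => i _; rewrite /f.
  by rewrite -PoszD addnC.
by rewrite addrC subzn.
Qed.

Lemma lattice_polyB K c c' :
  lattice_poly K c - lattice_poly K c' = lattice_poly K (fun z => c z - c' z).
Proof.
by apply/polyP => j; rewrite coefB !coef_poly; case: ifP; rewrite ?subr0.
Qed.

(* Taylor expansion of X^(K + m) at X = 1, and of 1 = X^m (1 / X)^m in powers of
   1 - X for X^(K - m). *)
Lemma lattice_expansion K s c : (s <= K)%N -> exists E V : {poly R},
  [/\ lattice_poly K c = E + ('X - 1) ^+ s.+1 * V,
      l1 E <= `|\sum_(m < K.+1) c m%:Z + \sum_(m < K) c (- m.+1%:Z)| +
        \sum_(k < s) 2 ^+ k.+1 *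
          (`|\sum_(m < K.+1) c m%:Z * 'C(m, k.+1)%:R| +
           `|\sum_(m < K.+1) c (- m%:Z) * 'C(m, k.+1)%:R|) &
      l1 V <= \sum_(m < K.+1) `|c m%:Z| * 'C(m, s.+1)%:R +
              \sum_(m < K.+1) `|c (- m%:Z)| * 'C(m, s.+1)%:R].
Proof.
move=> sK.
have X1 : l1 ('X : {poly R}) <= 1 by rewrite -['X]expr1 l1Xn.
have one1 : l1 (1 : {poly R}) <= 1 by rewrite l1_1.
(* The negative half starts at m = 1; a term at m = 0 may be added, since C(0, k + 1) = 0. *)
have left0 (f : nat -> R) : f 0%N = 0 -> \sum_(m < K) f m.+1 = \sum_(m < K.+1) f m.
  by move=> f0; rewrite big_ord_recl f0 add0r.
pose Wr m : {poly R} := 'X^K * taylor_rem s m 'X 1.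
(* The sign turns (1 - X)^(s+1) into (X - 1)^(s+1), so that both halves share one factor. *)
pose Wl m : {poly R} := (-1) ^+ s.+1 * ('X^(K - m) * taylor_rem s m 1 'X).
have mr m : 'X^(K + m) = \sum_(k < s.+1) 'C(m, k)%:R *: ('X^K * ('X - 1) ^+ k) +
    ('X - 1) ^+ s.+1 * Wr m.
  rewrite exprD (taylor_exprn s m 'X 1) mulrDr mulr_sumr; congr (_ + _).
    by apply: eq_bigr => k _; rewrite expr1n mul1r scaler_nat mulrnAr.
  by rewrite /Wr mulrCA.
have ml m : (m <= K)%N -> 'X^(K - m) =
    \sum_(k < s.+1) 'C(m, k)%:R *: ('X^(K - k) * (1 - 'X) ^+ k) +
    ('X - 1) ^+ s.+1 * Wl m.
  move=> mK; have {1}-> : 'X^(K - m) = 'X^(K - m) * 1 ^+ m :> {poly R} by rewrite expr1n mulr1.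
  rewrite (taylor_exprn s m 1 'X) mulrDr mulr_sumr; congr (_ + _).
    apply: eq_bigr => k _; rewrite scaler_nat mulrnAr.
    have [km|mk] := leqP k m; last by rewrite bin_small.
    by rewrite mulrA -exprD addnBA// subnK.
  rewrite /Wl [RHS]mulrA -exprMn mulrN1 opprB mulrCA//.
have lWr m : l1 (Wr m) <= 'C(m, s.+1)%:R.
  by rewrite -[leRHS]mul1r l1M_le ?l1Xn// l1_taylor_rem.
have lWl m : l1 (Wl m) <= 'C(m, s.+1)%:R.
  rewrite -[leRHS]mul1r l1M_le//; first by rewrite l1X_le1// l1N.
  by rewrite -[leRHS]mul1r l1M_le ?l1Xn// l1_taylor_rem.
pose A k := \sum_(m < K.+1) c m%:Z * 'C(m, k)%:R.
pose B k := \sum_(m < K) c (- m.+1%:Z) * 'C(m.+1, k)%:R.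
pose e k : {poly R} := A k *: ('X^K * ('X - 1) ^+ k) + B k *: ('X^(K - k) * (1 - 'X) ^+ k).
pose V := \sum_(m < K.+1) c m%:Z *: Wr m + \sum_(m < K) c (- m.+1%:Z) *: Wl m.+1.
exists (\sum_(k < s.+1) e k), V; split.
- rewrite lattice_polyE /e big_split/= /V mulrDr addrACA !mulr_sumr.
  congr (_ + _).
    rewrite (eq_bigr _ (fun (m : 'I_K.+1) _ => congr1 (fun z => c m%:Z *: z) (mr m))).
    under eq_bigr do rewrite scalerDr scaler_sumr.
    rewrite big_split/= exchange_big/=; congr (_ + _); last first.
      by apply: eq_bigr => m _; rewrite scalerAr.
    by apply: eq_bigr => k _; rewrite /A scaler_suml; apply: eq_bigr => m _; rewrite scalerA.
  rewrite (eq_bigr _ (fun (m : 'I_K) _ => congr1 (fun z => c (- m.+1%:Z) *: z) (ml _ (ltn_ord m)))).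
  under eq_bigr do rewrite scalerDr scaler_sumr.
  rewrite big_split/= exchange_big/=; congr (_ + _); last first.
    by apply: eq_bigr => m _; rewrite scalerAr.
  by apply: eq_bigr => k _; rewrite /B scaler_suml; apply: eq_bigr => m _; rewrite scalerA.
- rewrite big_ord_recl (le_trans (l1D _ _))// lerD//.
    (* At order 0 both halves multiply the same power X^K, so their masses are added before the
       absolute value is taken. *)
    rewrite /e !expr0 !mulr1 subn0 -scalerDl l1Z l1Xn mulr1 /A /B.
    by under eq_bigr do rewrite bin0 mulr1; under [in X in _ + X]eq_bigr do rewrite bin0 mulr1.
  rewrite (le_trans (l1_sum _ _ _))//; apply: ler_sum => k _.
  rewrite /e /A /B /= /bump /= ?add1n (le_trans (l1D _ _))// !l1Z mulrDr lerD//.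
    rewrite mulrC ler_wpM2r// -[leRHS]mul1r l1M_le ?l1Xn//.
    by rewrite (le_trans (l1X _ _))// lerXn2r ?nnegrE ?l1_ge0// l1_Xsub1.
  rewrite (left0 (fun m => c (- m%:Z) * 'C(m, k.+1)%:R)) ?bin0n ?mulr0//.
  rewrite mulrC ler_wpM2r// -[leRHS]mul1r l1M_le ?l1Xn//.
  by rewrite (le_trans (l1X _ _))// lerXn2r ?nnegrE ?l1_ge0// -l1N opprB l1_Xsub1.
- rewrite (le_trans (l1D _ _))// lerD// (le_trans (l1_sum _ _ _))//.
    by apply: ler_sum => m _; rewrite l1Z ler_wpM2l.
  rewrite -(left0 (fun m => `|c (- m%:Z)| * 'C(m, s.+1)%:R)) ?bin0n ?mulr0//.
  by apply: ler_sum => m _; rewrite l1Z ler_wpM2l.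
Qed.

End LatticePoly.

(** * Exchanging the laws one index at a time *)

Section Swap.
Context {R : realType}.
Implicit Types (p q r E V : {poly R}) (g h : R -> R).

(** The bound of [l1_smoothing] for a share of n / (2 (s + 1)) copies: half of the n copies, divided
    among s + 1 factors X - 1. *)
Definition rate (s n : nat) (v : R) : R := 2 / Num.sqrt (n%:R * v / (2 * s.+1%:R)).

Lemma rate_ge0 s n v : 0 <= rate s n v.
Proof. by rewrite divr_ge0// sqrtr_ge0. Qed.

Lemma l1_smoothing_rate s n m (v : R) r : (forall j, 0 <= r`_j) -> l1 r <= 1 ->
  0 < v -> v <= overlap r -> (0 < n)%N -> (n <= 2 * s.+1 * m.+1)%N ->
  l1 (('X - 1) * r ^+ m) <= rate s n v.
Proof.
move=> r0 r1 v0 vr n0 nm; rewrite (le_trans (l1_smoothing m r0 r1 v0 vr))//.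
rewrite /rate ler_pM2l// lef_pV2 ?posrE ?sqrtr_gt0 ?divr_gt0 ?mulr_gt0 ?ltr0n//.
rewrite ler_wsqrtr// ler_pdivrMr ?mulr_gt0// mulrAC ler_pM2r//.
by rewrite -!natrM ler_nat mulnC.
Qed.

(* With m = a / (s + 1), s of the s + 1 factors X - 1 are absorbed by copies of
   r^m in l1; the last one, with its r^m, is left to g. *)
Lemma act_smooth_pow (w : R) s n (v : R) V r r' a b g (eta : R) : (0 < n)%N ->
  (forall j, 0 <= r`_j) -> l1 r <= 1 -> 0 < v -> v <= overlap r -> l1 r' <= 1 ->
  (n <= 2 * a.+1)%N -> 0 <= eta ->
  (forall m y, (n <= 2 * s.+1 * m.+1)%N -> `|act w (('X - 1) * r ^+ m) g y| <= eta) ->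
  forall y, `|act w (('X - 1) ^+ s.+1 * V * (r ^+ a * r' ^+ b)) g y| <=
    l1 V * rate s n v ^+ s * eta.
Proof.
move=> n0 r0 r1 v0 vr r'1 na eta0 heta y.
pose m := (a %/ s.+1)%N.
have nm : (n <= 2 * s.+1 * m.+1)%N.
  by rewrite (leq_trans na)// -mulnA leq_mul2l/= [X in (_ <= X)%N]mulnC ltn_ceil.
have aE : a = (m * s + m + a %% s.+1)%N.
  by rewrite {1}(divn_eq a s.+1) -/m mulnS [(m + _)%N]addnC.
have -> : ('X - 1) ^+ s.+1 * V * (r ^+ a * r' ^+ b) =
    V * (('X - 1) * r ^+ m) ^+ s * (r ^+ (a %% s.+1) * r' ^+ b) * (('X - 1) * r ^+ m).
  rewrite {1}aE !exprD exprMn exprS -exprM; ring.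
rewrite actM; apply: (le_trans (act_le _ _ (fun y => heta m y nm) y)).
rewrite ler_wpM2r// -[leRHS]mulr1; apply: l1M_le; last first.
  by rewrite -[leRHS]mulr1; apply: l1M_le; exact: l1X_le1.
apply: l1M_le => //; rewrite (le_trans (l1X _ _))//.
by rewrite lerXn2r ?nnegrE ?l1_ge0 ?rate_ge0// l1_smoothing_rate.
Qed.

Lemma act_pow_diff (w : R) s n (v : R) E V p q g (eta : R) : (0 < n)%N ->
  (forall j, 0 <= p`_j) -> (forall j, 0 <= q`_j) -> l1 p <= 1 -> l1 q <= 1 ->
  0 < v -> v <= overlap p -> v <= overlap q ->
  p - q = E + ('X - 1) ^+ s.+1 * V ->
  (forall y, `|g y| <= 1) -> 0 <= eta ->
  (forall r m y, r = p \/ r = q -> (n <= 2 * s.+1 * m.+1)%N ->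
    `|act w (('X - 1) * r ^+ m) g y| <= eta) ->
  forall y, `|act w (p ^+ n) g y - act w (q ^+ n) g y| <=
    n%:R * (l1 E + l1 V * rate s n v ^+ s * eta).
Proof.
move=> n0 p0 q0 p1 q1 v0 vp vq pq g1 eta0 heta y.
rewrite -actB subrXX mulr_sumr act_sum (le_trans (ler_norm_sum _ _ _))//.
set rhs := l1 E + _.
apply: (le_trans (y := \sum_(i < n) rhs)); last by rewrite sumr_const card_ord mulr_natl.
apply: ler_sum => i _; rewrite pq mulrDl actD (le_trans (ler_normD _ _))// lerD//.
  rewrite (le_trans (act_le _ _ g1 _))// mulr1 -[leRHS]mulr1 l1M_le//.
  by rewrite -[leRHS]mulr1 l1M_le// l1X_le1.
(* The exponents n - 1 - i and i add up to n - 1, so at least one of them, [a], satisfies n <= 2 (a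
   + 1); that law does the smoothing. *)
have [ni|ni] := leqP n (2 * (n.-1 - i).+1).
  by apply: (@act_smooth_pow w s n v V p q) => // m z; apply: heta; left.
rewrite [p ^+ _ * _]mulrC.
apply: (@act_smooth_pow w s n v V q p) => //; last by move=> m z; apply: heta; right.
by have := ltn_ord i; move: (nat_of_ord i) ni n0; clear; case: n => // n k; rewrite /=; lia.
Qed.

(** Cover the shift by L = floor(w / w0) + 1 steps of length [w0], each losing at most [e]. As g
    decreases, overshooting only enlarges the loss, and L <= w / w0 + 1. *)
Lemma increment_le g (w w0 e : R) : 0 < w0 -> 0 < w ->
  {homo g : x y /~ x <= y} -> (forall y, `|g (y + w0) - g y| <= e) ->
  forall y, `|g (y + w) - g y| <= (w / w0 + 1) * e.
Proof.
move=> w00 w0' gd ge y.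
have e0 : 0 <= e by exact: le_trans (ge 0).
have step L : g y - g (y + L%:R * w0) <= L%:R * e.
  elim: L => [|L ih]; first by rewrite !mul0r addr0 subrr.
  have := ge (y + L%:R * w0); rewrite ler_norml => /andP[+ _].
  rewrite -addrA -{2}[w0]mul1r -mulrDl -natr1 mulrDl mul1r; lra.
pose L := (Num.truncn (w / w0)).+1.
have q0 : 0 <= w / w0 by rewrite divr_ge0// ltW.
have /andP[l1' l2] := truncn_itv q0.
have wL : w <= L%:R * w0 by rewrite -ler_pdivrMr// ltW.
rewrite ler0_norm; last by rewrite subr_le0 gd// lerDl ltW.
rewrite opprB (le_trans (y := g y - g (y + L%:R * w0)))//.
  by rewrite lerD2l lerN2 gd// lerD2l.
rewrite (le_trans (step L))// ler_wpM2r// /L -natr1 lerD2r//.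
Qed.

Lemma acts_decr (c : seq (R * {poly R})) h :
  (forall x, x \in c -> 0 <= x.1 /\ forall j, 0 <= x.2`_j) ->
  {homo h : x y /~ x <= y} -> {homo acts c h : x y /~ x <= y}.
Proof.
move=> + hd; elim: c => //= x c ih xc; have [w0 x0] := xc _ (mem_head _ _).
by apply: act_decr => //; apply: ih => z zc; apply: xc; rewrite inE zc orbT.
Qed.

Lemma coef_exp_ge0 p n : (forall j, 0 <= p`_j) -> forall j, 0 <= (p ^+ n)`_j.
Proof.
move=> p0; elim: n => [|n ih] j; first by rewrite expr0 coef1.
by rewrite exprS coef_poly_ge0M.
Qed.

(* All the laws but the one being exchanged contribute l1-norms at most 1, except
   that the law of index j0 supplies the last smoothing factor. *)
Lemma acts_swap (N s : nat) (w : 'I_N -> R) (p q E V : 'I_N -> {poly R})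
    (n : 'I_N -> nat) (v : 'I_N -> R) (h : R -> R) (j0 : 'I_N) :
  (forall i, 0 < w i) -> (forall i, 0 < n i)%N ->
  (forall i j, 0 <= (p i)`_j) -> (forall i j, 0 <= (q i)`_j) ->
  (forall i, l1 (p i) <= 1) -> (forall i, l1 (q i) <= 1) ->
  (forall i, 0 < v i) -> (forall i, v i <= overlap (p i)) ->
  (forall i, v i <= overlap (q i)) ->
  (forall i, p i - q i = E i + ('X - 1) ^+ s.+1 * V i) ->
  (forall y, `|h y| <= 1) -> {homo h : x y /~ x <= y} ->
  forall y, `|acts [seq (w i, p i ^+ n i) | i <- enum 'I_N] h y -
              acts [seq (w i, q i ^+ n i) | i <- enum 'I_N] h y| <=
    \sum_i (n i)%:R * (l1 (E i) + l1 (V i) * rate s (n i) (v i) ^+ s *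
                       ((w i / w j0 + 1) * rate s (n j0) (v j0))).
Proof.
move=> w0 n0 p0 q0 p1 q1 v0 vp vq pq h1 hd y.
(* Hybrid families: the indices below [k] are already exchanged. The difference telescopes over [k],
   and consecutive hybrids differ only at index [k]. *)
pose hyb k (i : 'I_N) := if (i < k)%N then q i else p i.
pose L k := [seq (w i, hyb k i ^+ n i) | i <- enum 'I_N].
have hybc k i j : 0 <= (hyb k i)`_j by rewrite /hyb; case: ifP.
have hyb1 k i : l1 (hyb k i) <= 1 by rewrite /hyb; case: ifP.
have hybv k i : v i <= overlap (hyb k i) by rewrite /hyb; case: ifP.
have -> : [seq (w i, p i ^+ n i) | i <- enum 'I_N] = L 0%N by [].
have -> : [seq (w i, q i ^+ n i) | i <- enum 'I_N] = L N.
  by apply: eq_map => i; rewrite /hyb ltn_ord.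
have tele : acts (L 0%N) h y - acts (L N) h y =
    \sum_(k < N) (acts (L k) h y - acts (L k.+1) h y).
  have := telescope_sumr (fun k => - acts (L k) h y) (leq0n N).
  rewrite big_mkord opprK addrC => <-.
  by apply: eq_bigr => k _; rewrite opprK addrC.
rewrite tele (le_trans (ler_norm_sum _ _ _))//; apply: ler_sum => i _.
pose rest := rem i (enum 'I_N).
have ien : i \in enum 'I_N by rewrite mem_enum.
have permi k : perm_eq (L k) ((w i, hyb k i ^+ n i) :: [seq (w j, hyb k j ^+ n j) | j <- rest]).
  exact: (perm_map _ (perm_to_rem ien)).
have urest : uniq (i :: rest) by rewrite -(perm_uniq (perm_to_rem ien)) enum_uniq.
have restE : [seq (w j, hyb i.+1 j ^+ n j) | j <- rest] =
             [seq (w j, hyb i j ^+ n j) | j <- rest].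
  apply/eq_in_map => j jr; congr (_, _ ^+ _); rewrite /hyb ltnS leq_eqVlt.
  case: eqP => //= /val_inj ji; move: urest; rewrite /= -ji jr//.
rewrite (acts_perm _ (permi i)) (acts_perm _ (permi i.+1)) restE /=.
set c := [seq _ | j <- rest]; set g := acts c h.
have cP x : x \in c -> [/\ l1 x.2 <= 1, 0 <= x.1 & forall j, 0 <= x.2`_j].
  move=> /mapP[j _ ->]; split => /=; first by rewrite l1X_le1.
    by rewrite ltW.
  exact: coef_exp_ge0.
have g1 z : `|g z| <= 1 by apply: acts_le => // x /cP[].
have -> : hyb i i = p i by rewrite /hyb ltnn.
have -> : hyb i.+1 i = q i by rewrite /hyb ltnSn.
have rt0 := rate_ge0 s (n j0) (v j0).
have ww : 0 <= w i / w j0 by rewrite divr_ge0// ltW.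
apply: (act_pow_diff (n0 i) (p0 i) (q0 i) (p1 i) (q1 i) (v0 i)) => //.
  by rewrite mulr_ge0// addr_ge0.
move=> r m z rpq nm.
have rc j : 0 <= r`_j by case: rpq => ->.
have r1 : l1 r <= 1 by case: rpq => ->.
have rv : v i <= overlap r by case: rpq => ->.
(* For i = j0 the spare copies of the exchanged law itself absorb the last X - 1. *)
have [ij|ij] := eqVneq i j0.
  rewrite -ij divff ?gt_eqF// (le_trans (act_le _ _ g1 _))// mulr1.
  rewrite (le_trans (l1_smoothing_rate rc r1 (v0 i) rv (n0 i) nm))//.
  by have := rate_ge0 s (n i) (v i); lra.
(* For i different from j0 the copies of [r] are discarded, and X - 1 becomes an increment of the
   decreasing function [g]. *)
rewrite mulrC actM; apply: act_le1; [by rewrite mulr_ge0// addr_ge0|exact: l1X_le1|].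
move=> {}z; rewrite act_Xsub1.
have jr : j0 \in rest.
  by have := perm_mem (perm_to_rem ien) j0; rewrite mem_enum inE eq_sym (negbTE ij).
(* The law of index [j0] is among the unchanged ones, with all its [n j0] copies available to smooth
   an increment by [w j0]. *)
have -> : g = act (w j0) (hyb i j0 ^+ n j0)
    (acts [seq (w j, hyb i j ^+ n j) | j <- rem j0 rest] h).
  exact: (acts_perm _ (perm_map _ (perm_to_rem jr))).
set c' := [seq _ | j <- rem _ _]; set g' := acts c' h.
have c'P x : x \in c' -> [/\ l1 x.2 <= 1, 0 <= x.1 & forall j, 0 <= x.2`_j].
  move=> /mapP[j _ ->]; split => /=; first by rewrite l1X_le1.
    by rewrite ltW.
  exact: coef_exp_ge0.
have g'd : {homo g' : x y /~ x <= y} by apply: acts_decr => // x /c'P[].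
apply: increment_le => //.
  by apply: act_decr => //; [rewrite ltW|exact: coef_exp_ge0].
move=> {}z; rewrite -act_Xsub1 -actM.
have g'1 t : `|g' t| <= 1 by apply: acts_le => // x /c'P[].
rewrite (le_trans (act_le _ _ g'1 _))// mulr1.
by apply: l1_smoothing_rate => //; rewrite mulnS; lia.
Qed.

End Swap.

(** * Point masses at the integers *)

Section Mass.
Context {R : realType}.

Definition mass (F : probability R R) (z : int) : R := fine (F [set z%:~R]).

Lemma massE F z : (mass F z)%:E = F [set z%:~R].
Proof. by rewrite fineK// fin_num_measure. Qed.

Lemma mass_ge0 F z : 0 <= mass F z.
Proof. by rewrite -lee_fin massE. Qed.

End Mass.

(** * Probabilities of half-line events under truncation *)

Section TruncatedEvent.
Context {R : realType} {d : measure_display} {T : measurableType d}.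
Variables (P : probability T R) (I : finType) (X : I -> {RV P >-> R}).
Hypothesis Xint : forall k, integer_valued (X k).
Hypothesis Xind : mutually_independent X.
Variables (om : I -> R) (K : nat).

(* The variables outside l are confined to A, those in l to [-K, K], and the
   weighted sum runs over l only; peeling off the head of l makes this a sum over
   its 2K + 1 values. *)
Definition trunc_event (l : seq I) (A : I -> set R) (x y : R) : set T :=
  [set t | [/\ forall k, k \notin l -> A k (X k t),
               forall k, k \in l -> `|X k t| <= K%:R &
               y + \sum_(k <- l) om k * (X k t + K%:R) <= x]].

Definition halfline (x y : R) : R := (y <= x)%R%:R.

(** Split by the value j - K of [X k]: fixing it is a condition on a variable now outside [l], and
    its contribution [om k * j] moves into the starting point. *)
Lemma trunc_event_cons k l A x y : k \notin l ->
  trunc_event (k :: l) A x y =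
  \big[setU/set0]_(j < K + K.+1)
    trunc_event l (fun i => if i == k then [set (j%:Z - K%:Z)%:~R] else A i) x
      (y + om k * j%:R).
Proof.
move=> kl; rewrite -bigcup_seq; apply/seteqP; split => t /=.
  move=> [hA hK hx].
  have := hK k (mem_head _ _); have /intrP[z Xz] := Xint k t.
  rewrite Xz -intr_norm -[K%:R]/((K%:Z)%:~R) ler_int => zK.
  have jK : (absz (z + K%:Z)%R < K + K.+1)%N by lia.
  have jE : ((Ordinal jK)%:Z - K%:Z) = z by rewrite /=; lia.
  exists (Ordinal jK); first by rewrite /= mem_index_enum.
  split.
  - move=> i il; case: eqP => [->|/eqP ik]; first by rewrite Xz; exact: (congr1 (fun u : int => u%:~R) (esym jE)).
    by apply: hA; rewrite inE negb_or ik.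
  - by move=> i il; apply: hK; rewrite inE il orbT.
  - move: hx; rewrite big_cons addrA; congr (_ + _ * _ + _ <= _).
    rewrite Xz -[K%:R]/((K%:Z)%:~R) -intrD.
    by rewrite -[X in _ = X]/((Posz (absz (z + K%:Z)%R))%:~R) -[X in (X + _)%:~R]jE subrK.
move=> [j _ [hA hK hx]].
have Xk : X k t = (j%:Z - K%:Z)%:~R by have := hA k kl; rewrite eqxx.
split.
- move=> i; rewrite inE negb_or => /andP[ik il].
  by have := hA i il; rewrite (negbTE ik).
- move=> i; rewrite inE => /predU1P[->|/hK//].
  rewrite Xk -intr_norm -[K%:R]/((K%:Z)%:~R) ler_int.
  by have := ltn_ord j; lia.
- rewrite big_cons addrA Xk -[K%:R]/((K%:Z)%:~R) -intrD subrK//.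
Qed.

(** Induction on [l]. For the empty list independence gives the product, and the sum condition
    reduces to y <= x. Each variable put into [l] turns its factor P(X k = j - K) into a coefficient
    of its polynomial. *)
Lemma trunc_eventP l A x y : uniq l -> (forall k, measurable (A k)) ->
  measurable (trunc_event l A x y) /\
  P (trunc_event l A x y) = ((\prod_(k | k \notin l) fine (P (X k @^-1` A k))) *
    acts [seq (om k, lattice_poly K (mass (distribution P (X k)))) | k <- l]
         (halfline x) y)%:E.
Proof.
elim: l A y => [|k l ih] A y.
  move=> _ mA /=; rewrite /halfline.
  have capE : \bigcap_(i in [set` [set: I]%SET]) (X i @^-1` A i) =
              [set t | forall k, A k (X k t)].
    by apply/seteqP; split => t h i; [apply: h; rewrite /= inE|move=> _; exact: h].
  have mX i : measurable (X i @^-1` A i).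
    by rewrite -[X in measurable X]setTI; exact: measurable_funPT.
  have mcap : measurable (\bigcap_(i in [set` [set: I]%SET]) (X i @^-1` A i)).
    by apply: fin_bigcap_measurable => //; exact: finite_finset.
  have [yx|yx] := leP y x.
    have -> : trunc_event [::] A x y = \bigcap_(i in [set` [set: I]%SET]) (X i @^-1` A i).
      rewrite capE; apply/seteqP; split => t /=; first by move=> [h _ _] i; exact: h.
      by move=> h; split => //; rewrite big_nil addr0.
    split => //; rewrite Xind// mulr1 -prodEFin; apply: eq_big => i; first by rewrite inE.
    by move=> _; rewrite fineK// fin_num_measure.
  have -> : trunc_event [::] A x y = set0.
    by apply/seteqP; split => t //= [_ _]; rewrite big_nil addr0 leNgt yx.
  by split => //; rewrite measure0 mulr0.
rewrite cons_uniq => /andP[kl ul] mA; rewrite trunc_event_cons//.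
set A' := fun (j : nat) i => if i == k then [set (j%:Z - K%:Z)%:~R] else A i.
have mA' j i : measurable (A' j i) by rewrite /A'; case: ifP.
split; first by apply: bigsetU_measurable => j _; have [] := ih (A' j) (y + om k * j%:R) ul (mA' j).
rewrite measure_bigsetU_ord//; first last.
- apply/trivIsetP => i j _ _ ij; rewrite -subset0 => t [[h1 _ _] [h2 _ _]].
  have := h1 k kl; have := h2 k kl; rewrite /A' eqxx /= => ->.
  move/(intr_inj)/addIr => -[] /val_inj ji.
  by rewrite ji eqxx in ij.
- by move=> j; have [] := ih (A' j) (y + om k * j%:R) ul (mA' j).
rewrite (eq_bigr _ (fun (j : 'I__) _ => (ih (A' j) (y + om k * j%:R) ul (mA' j)).2)).
rewrite sumEFin /=; congr EFin.
rewrite (@act_widen _ _ _ _ _ (K + K.+1)) ?size_poly// mulr_sumr.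
apply: eq_bigr => j _; rewrite (bigD1 k)//= /A' eqxx coef_poly ltn_ord.
rewrite [RHS]mulrCA mulrA; congr (_ * _ * _).
apply: eq_big => i; first by rewrite inE negb_or andbC.
by move=> /andP[_ /negbTE ->].
Qed.

End TruncatedEvent.

(** * The cost of truncation *)

Section TruncationError.
Context {R : realType} {d : measure_display} {T : measurableType d}.
Variable P : probability T R.

(** This extracts the X's alone, and the Z's alone, from the joint family. *)
Lemma mutually_independent_comp (I J : finType) (X : I -> {RV P >-> R}) (f : J -> I) :
  injective f -> mutually_independent X -> mutually_independent (X \o f).
Proof.
move=> finj Xind B A mA.
(* Indices outside the image of [f] receive the whole line, so they impose no condition. *)
pose A' i := if [pick j | f j == i] is Some j then A j else setT.
have A'f j : A' (f j) = A j.
  rewrite /A'; case: pickP => [j' /eqP /finj -> //|/(_ j)].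
  by rewrite eqxx.
have mA' i : measurable (A' i) by rewrite /A'; case: pickP.
have := Xind (f @: B)%SET A' mA'.
rewrite big_imset/=; last by move=> x y _ _ /finj.
under eq_bigr do rewrite A'f.
move=> <-; congr (P _); apply/seteqP; split => t /= h.
  by move=> i /= /imsetP[j jB ->]; rewrite /= A'f; exact: h.
by move=> j /= jB; rewrite -A'f; apply: h; rewrite /= imset_f.
Qed.

Section Family.
Variables (I : finType) (X : I -> {RV P >-> R}).
Hypothesis Xint : forall k, integer_valued (X k).
Hypothesis Xind : mutually_independent X.

Definition tail_event (K : nat) : set T := [set t | exists k, K%:R < `|X k t|].

Lemma measurable_tail_event K : measurable (tail_event K).
Proof.
have -> : tail_event K = \bigcup_(k in [set: I]) (X k @^-1` [set r | K%:R < `|r|]).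
  by apply/seteqP; split => t /= [k]; [exists k|exists k].
apply: fin_bigcup_measurable; first exact: finite_finset.
move=> k _; rewrite -[X in measurable X]setTI; apply: measurable_funPT => //.
have -> : [set r : R | K%:R < `|r|] = ~` `[- K%:R, K%:R].
  apply/seteqP; split => r /=; rewrite in_itv/= -ler_norml ltNge; first by move/negP.
  by move=> h; apply/negP.
exact: measurableC.
Qed.

(** The events decrease to the empty set, because at each point the finitely many variables are
    bounded by the sum of their absolute values. *)
Lemma tail_event_cvg : fine (P (tail_event K)) @[K --> \oo] --> (0 : R).
Proof.
have cap0 : \bigcap_K tail_event K = set0.
  rewrite -subset0 => t h /=.
  pose M : R := \sum_k `|X k t|.
  have M0 : 0 <= M by exact: sumr_ge0.
  have [k] := h (Num.truncn M).+1 Logic.I; have /andP[_ /ltW h2] := truncn_itv M0.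
  move=> /(le_lt_trans h2); rewrite ltNge /M (bigD1 k)//= lerDl sumr_ge0//.
have : P \o tail_event @ \oo --> P (\bigcap_K tail_event K).
  apply: nonincreasing_cvg_mu.
  - by rewrite ltey_eq fin_num_measure//; exact: measurable_tail_event.
  - exact: measurable_tail_event.
  - by rewrite cap0.
  - apply/nonincreasing_seqP => K; apply/subsetPset => t [k hk]; exists k.
    by apply: le_lt_trans hk; rewrite ler_nat.
by rewrite cap0 measure0; exact: fine_cvg.
Qed.

(** The expression with [acts] is the probability of [L] outside the tail event; the starting point
    undoes the offset by K of every variable. *)
Lemma trunc_approx (om : I -> R) (K : nat) (x : R) (L : set T) :
  measurable L -> L = [set t | \sum_k om k * X k t <= x] ->
  `|fine (P L) -
    acts [seq (om k, lattice_poly K (mass (distribution P (X k)))) | k <- enum I]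
      (halfline x) (- \sum_k om k * K%:R)| <= fine (P (tail_event K)).
Proof.
move=> mL LE.
have [mE PE] := @trunc_eventP _ _ _ P I X Xint Xind om K (enum I) (fun=> setT) x
  (- \sum_k om k * K%:R) (enum_uniq _) (fun=> measurableT).
move: PE; rewrite big_pred0 ?mul1r; last by move=> k; rewrite mem_enum.
set a := acts _ _ _ => PE.
have EE : trunc_event X om K (enum I) (fun=> setT) x (- \sum_k om k * K%:R) =
    L `\` tail_event K.
  have sumE t : - (\sum_k om k * K%:R) + \sum_(k <- enum I) om k * (X k t + K%:R) =
      \sum_k om k * X k t.
    rewrite big_enum/=; under [X in _ + X]eq_bigr do rewrite mulrDr.
    by rewrite big_split/= addrCA addNr addr0.
  apply/seteqP; split => t /=.
    move=> [_ hK]; rewrite sumE LE => hx; split => // -[k]; rewrite ltNge hK//.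
    by rewrite mem_enum.
  rewrite LE => -[hx ht]; split => //; last by rewrite sumE.
  by move=> k _; rewrite leNgt; apply/negP => h; apply: ht; exists k.
have mt := measurable_tail_event K.
have <- : fine (P (L `\` tail_event K)) = a by rewrite -EE PE.
have h1 : fine (P (L `\` tail_event K)) <= fine (P L).
  rewrite fine_le ?fin_num_measure//; first exact: measurableD.
  by apply: le_measure; rewrite ?inE//; exact: measurableD.
rewrite ger0_norm ?subr_ge0// lerBlDl.
rewrite -lee_fin EFinD !fineK ?fin_num_measure//; last exact: measurableD.
apply: le_trans (measureU2 _ (measurableD mL mt) mt).
apply: le_measure; rewrite ?inE//; first by apply: measurableU => //; exact: measurableD.
by move=> t Lt; have [ht|ht] := pselect (tail_event K t); [right|left].
Qed.

End Family.

End TruncationError.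

(** * Overlaps and the total variation norm *)

Section Overlap.
Context {R : realType}.

Lemma sum_measure_set1_le (mu : {measure set R -> \bar R}) (s : seq R) : uniq s ->
  (\sum_(x <- s) mu [set x] <= mu setT)%E.
Proof.
move=> us; rewrite (fsbig_seq _ _ us).
rewrite -(@measure_fin_bigcup _ _ _ mu _ [set` s] (fun x => [set x]))//.
- apply: le_measure; rewrite ?inE//.
  by apply: fin_bigcup_measurable => //; exact: finite_seq.
- exact: finite_seq.
- by apply/trivIsetP => x y _ _ xy; rewrite -subset0 => z [/= -> /eqP]; exact/negP.
Qed.

Lemma tv_norm_fin_num (M : {charge set R -> \bar R}) : tv_norm M \is a fin_num.
Proof. by rewrite /tv_norm fin_numD !fin_num_measure. Qed.

(** Each atom satisfies |M{x}| <= M^+{x} + M^-{x}. This lower bound on the norm becomes an upper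
    bound on [u_of], hence a lower bound on overlaps. *)
Lemma sum_charge_set1_le_tv (M : {charge set R -> \bar R}) (s : seq R) : uniq s ->
  \sum_(x <- s) `|fine (M [set x])| <= fine (tv_norm M).
Proof.
move=> us; rewrite -lee_fin fineK ?tv_norm_fin_num// -sumEFin /tv_norm.
set p := jordan_pos _; set q := jordan_neg _.
rewrite (@le_trans _ _ (\sum_(x <- s) (p [set x] + q [set x])))%E//; last first.
  by rewrite big_split/=; apply: leeD; exact: sum_measure_set1_le.
apply: lee_sum => x _.
have pf : p [set x] \is a fin_num by rewrite fin_num_measure.
have qf : q [set x] \is a fin_num by rewrite fin_num_measure.
have -> : M [set x] = (p [set x] - q [set x])%E.
  by rewrite (jordan_decomp (svalP (hahn_sets M)))// /cadd/= cscaleN1.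
rewrite -(fineK pf) -(fineK qf) -EFinB /= -EFinD lee_fin (le_trans (ler_normB _ _))//.
by rewrite !ger0_norm// fine_ge0.
Qed.

Lemma shift_diff_set1 (F : probability R R) (z : int) :
  fine (shift_diff F [set z%:~R]) = mass F (z - 1) - mass F z.
Proof.
rewrite charge_subE !convolution_dirac//.
have -> : [set x : R | [set z%:~R] (x + 1)] = [set (z - 1)%:~R].
  apply/seteqP; split => x /=; first by rewrite intrB => <-; rewrite addrK.
  by move=> ->; rewrite intrB subrK.
have -> : [set x : R | [set z%:~R] (x + 0)] = [set z%:~R].
  by apply/seteqP; split => x /=; rewrite addr0.
by rewrite -!massE.
Qed.

Lemma coef_lattice_poly K (c : int -> R) j : (j < K + K.+1)%N ->
  (lattice_poly K c)`_j = c (j%:Z - K%:Z).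
Proof. by move=> jK; rewrite coef_poly jK. Qed.

Lemma lattice_poly_ge0 K (F : probability R R) j : 0 <= (lattice_poly K (mass F))`_j.
Proof. by rewrite coef_poly; case: ifP => // _; exact: mass_ge0. Qed.

Lemma l1_lattice_poly K (F : probability R R) :
  l1 (lattice_poly K (mass F)) = \sum_(j < K + K.+1) mass F (j%:Z - K%:Z).
Proof.
rewrite (l1_widen (size_poly _ _)); apply: eq_bigr => j _.
by rewrite ger0_norm ?lattice_poly_ge0// coef_lattice_poly.
Qed.

(** Sum min(a, b) = (a + b - |a - b|) / 2 over neighbouring points of [-K-1, K+1]. Both sums of
    masses cover [-K, K], and the differences are atoms of [shift_diff F]. *)
Lemma overlap_lattice_poly K (F : probability R R) :
  1 - 2^-1 * fine (tv_norm (shift_diff F)) <=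
  overlap (lattice_poly K.+1 (mass F)) + (1 - l1 (lattice_poly K (mass F))).
Proof.
pose a j := mass F (j%:Z - K.+1%:Z); pose n := (K + K.+1).+1.
pose s : seq R := [seq (j%:Z - K%:Z)%:~R | j <- iota 0 n].
have us : uniq s.
  rewrite map_inj_uniq ?iota_uniq// => i j /intr_inj /addIr [] //.
have := sum_charge_set1_le_tv (shift_diff F) us; rewrite big_map.
rewrite (eq_bigr (fun j => `|a j - a j.+1|)); last first.
  by move=> j _; rewrite shift_diff_set1 /a; congr `|mass F _ - mass F _|; lia.
rewrite -[iota 0 n]/(index_iota 0 n) big_mkord => tvge.
have ovE : overlap (lattice_poly K.+1 (mass F)) = \sum_(j < n) Num.min (a j) (a j.+1).
  have sz : (size (lattice_poly K.+1 (mass F)) <= n.+1)%N.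
    by rewrite (leq_trans (size_poly _ _))// /n addnS addSn.
  (* The last term pairs the top coefficient with a 0 beyond the degree and vanishes. *)
  rewrite (overlap_widen sz) big_ord_recr/=.
  rewrite [X in Num.min _ X]nth_default ?min_r ?lattice_poly_ge0// addr0.
  apply: eq_bigr => j _; rewrite !coef_lattice_poly//.
    by have := ltn_ord j; rewrite /n; lia.
  by have := ltn_ord j; rewrite /n; lia.
have minE : \sum_(j < n) Num.min (a j) (a j.+1) =
    2^-1 * (\sum_(j < n) a j + \sum_(j < n) a j.+1 - \sum_(j < n) `|a j - a j.+1|).
  rewrite -big_split -sumrB mulr_sumr; apply: eq_bigr => j _ /=.
  have [h|h] := leP (a j) (a j.+1).
    by rewrite ler0_norm ?subr_le0//; lra.
  by rewrite gtr0_norm ?subr_gt0//; lra.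
have s1 : l1 (lattice_poly K (mass F)) <= \sum_(j < n) a j.
  rewrite l1_lattice_poly /n big_ord_recl -[leLHS]add0r lerD ?mass_ge0//.
  by rewrite le_eqVlt; apply/orP; left; apply/eqP; apply: eq_bigr => j _;
     rewrite /a lift0; congr (mass F _); lia.
have s2 : l1 (lattice_poly K (mass F)) <= \sum_(j < n) a j.+1.
  rewrite l1_lattice_poly /n big_ord_recr/= -[leLHS]addr0 lerD ?mass_ge0//.
  by rewrite le_eqVlt; apply/orP; left; apply/eqP; apply: eq_bigr => j _;
     rewrite /a; congr (mass F _); lia.
rewrite ovE minE; lra.
Qed.

Definition lattice_points (K : nat) : set R :=
  \big[setU/set0]_(j < K + K.+1) [set (j%:Z - K%:Z)%:~R].

Lemma measure_lattice_points K (F : probability R R) :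
  F (lattice_points K) = (l1 (lattice_poly K (mass F)))%:E.
Proof.
rewrite /lattice_points measure_bigsetU_ord//.
  by rewrite l1_lattice_poly -sumEFin; apply: eq_bigr => j _; rewrite massE.
apply/trivIsetP => i j _ _ ij; rewrite -subset0 => x [/= -> /intr_inj/addIr [] /val_inj].
by move/eqP; apply/negP.
Qed.

Lemma l1_lattice_poly_le1 K (F : probability R R) : l1 (lattice_poly K (mass F)) <= 1.
Proof.
rewrite -lee_fin -measure_lattice_points probability_le1//.
by apply: bigsetU_measurable.
Qed.

Lemma lattice_pointsP K (x : R) :
  lattice_points K x <-> exists2 z : int, x = z%:~R & (`|z| <= K%:Z).
Proof.
rewrite /lattice_points -bigcup_seq; split.
  by move=> [j _ /= ->]; exists (j%:Z - K%:Z) => //; have := ltn_ord j; lia.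
move=> [z -> zK].
have jK : (absz (z + K%:Z)%R < K + K.+1)%N by lia.
exists (Ordinal jK); first by rewrite /= mem_index_enum.
by congr (_%:~R) => /=; lia.
Qed.

(** Continuity from below: the points of [-K, K] exhaust the integers. *)
Lemma l1_lattice_poly_cvg (F : probability R R) :
  F [set x | x \is a Num.int] = 1%E ->
  l1 (lattice_poly K (mass F)) @[K --> \oo] --> (1 : R).
Proof.
move=> F1.
have UE : \bigcup_K lattice_points K = [set x | x \is a Num.int].
  apply/seteqP; split => x /=.
    by move=> [K _ /lattice_pointsP[z -> _]]; rewrite intr_int.
  by move=> /intrP[z ->]; exists (absz z) => //; apply/lattice_pointsP; exists z => //; lia.
have mL K : measurable (lattice_points K) by apply: bigsetU_measurable.
have : F \o lattice_points @ \oo --> F (\bigcup_K lattice_points K).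
  apply: nondecreasing_cvg_mu => //; first exact: bigcup_measurable.
  apply/nondecreasing_seqP => K; apply/subsetPset => x /lattice_pointsP[z -> zK].
  by apply/lattice_pointsP; exists z => //; lia.
rewrite UE F1 => /fine_cvg; apply: cvg_trans; apply: near_eq_cvg.
by near=> K; rewrite /= measure_lattice_points.
Unshelve. all: by end_near.
Qed.

End Overlap.

(** * Factorial moments as limits of finite sums *)

Section FactorialMoments.
Context {R : realType}.
Implicit Types f : nat -> R.

Definition fmoment f k : \bar R := (\sum_(k <= m <oo) (m ^_ k)%:R%:E * (f m)%:E)%E.

Definition fpart f k n : R := \sum_(m < n) (m ^_ k)%:R * f m.

Lemma fpartE f k n :
  (\sum_(k <= m < n) (m ^_ k)%:R%:E * (f m)%:E)%E = (fpart f k n)%:E.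
Proof.
rewrite big_geq_mkord /= big_mkcond /= /fpart -sumEFin; apply: eq_bigr => m _.
by case: leqP => //= mk; rewrite ffact_small// mul0r.
Qed.

Lemma fpart_le_fmoment f k n : (forall m, 0 <= f m) -> ((fpart f k n)%:E <= fmoment f k)%E.
Proof.
move=> f0; rewrite -fpartE; apply: nneseries_lim_ge => m _ _.
by rewrite -EFinM lee_fin mulr_ge0.
Qed.

Lemma fmoment_ge0 f k : (forall m, 0 <= f m) -> (0 <= fmoment f k)%E.
Proof. by move=> f0; rewrite (le_trans _ (fpart_le_fmoment k 0%N f0))// lee_fin /fpart big_ord0. Qed.

Lemma fpart_cvg f k : (forall m, 0 <= f m) -> fmoment f k \is a fin_num ->
  fpart f k n @[n --> \oo] --> fine (fmoment f k).
Proof.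
move=> f0 fk.
have cv : cvgn (fun n => \sum_(k <= m < n) (m ^_ k)%:R%:E * (f m)%:E)%E.
  by apply: is_cvg_nneseries => m _ _; rewrite -EFinM lee_fin mulr_ge0.
have : (fun n => \sum_(k <= m < n) (m ^_ k)%:R%:E * (f m)%:E)%E @ \oo --> (fine (fmoment f k))%:E.
  by rewrite fineK//; exact: cv.
move=> /fine_cvg; apply: cvg_trans; apply: near_eq_cvg.
by near=> n; rewrite /= fpartE.
Unshelve. all: by end_near.
Qed.

(** For m <= s the left side is at most m!; for m > s falling factorials grow with their order up to
    s + 1. *)
Lemma ffact_le_add k s m : (k <= s)%N -> (m ^_ k <= s`! + m ^_ s.+1)%N.
Proof.
move=> ks; have [ms|ms] := leqP m s.
  rewrite (leq_trans _ (leq_addr _ _))//.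
  have [mk|km] := ltnP m k; first by rewrite ffact_small.
  apply: leq_trans (leq_fact ms).
  by rewrite -(ffact_fact km) leq_pmulr// fact_gt0.
rewrite (leq_trans _ (leq_addl _ _))//.
have mono i : (k + i <= m)%N -> (m ^_ k <= m ^_ (k + i))%N.
  elim: i => [|i ih] kim; first by rewrite addn0.
  rewrite (leq_trans (ih _))//; first by lia.
  by rewrite addnS ffactnSr leq_pmulr// subn_gt0; lia.
by rewrite -(subnKC (leqW ks)) mono// subnKC// leqW.
Qed.

(** By [ffact_le_add], a lower moment is at most s! times the total mass plus the moment of order s
    + 1. *)
Lemma fmoment_fin_num f k s : (forall m, 0 <= f m) ->
  (forall n, \sum_(m < n) f m <= 1) -> (k <= s)%N ->
  fmoment f s.+1 \is a fin_num -> fmoment f k \is a fin_num.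
Proof.
move=> f0 f1 ks fs; rewrite ge0_fin_numE ?fmoment_ge0//.
apply: (@le_lt_trans _ _ ((s`!)%:R%:E + fmoment f s.+1)%E); last first.
  by rewrite -(fineK fs) -EFinD ltry.
apply: lime_le; first by apply: is_cvg_nneseries => m _ _; rewrite -EFinM lee_fin mulr_ge0.
near=> n; rewrite fpartE.
apply: (@le_trans _ _ ((s`!)%:R%:E + (fpart f s.+1 n)%:E)%E); last first.
  by rewrite leeD2l// fpart_le_fmoment.
rewrite -EFinD lee_fin /fpart.
apply: (@le_trans _ _ (\sum_(m < n) ((s`!)%:R * f m + (m ^_ s.+1)%:R * f m))).
  by apply: ler_sum => m _; rewrite -mulrDl -natrD ler_wpM2r// ler_nat ffact_le_add.
by rewrite big_split/= -mulr_sumr lerD2r -[leRHS]mulr1 ler_wpM2l ?ler0n ?f1.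
Unshelve. all: by end_near.
Qed.

Lemma sum_bin_le_fmoment f k n : (forall m, 0 <= f m) -> fmoment f k \is a fin_num ->
  \sum_(m < n) f m * 'C(m, k)%:R <= fine (fmoment f k).
Proof.
move=> f0 fk; rewrite -lee_fin fineK// (le_trans _ (fpart_le_fmoment k n f0))//.
rewrite lee_fin; apply: ler_sum => m _; rewrite mulrC ler_wpM2r// ler_nat.
by rewrite -bin_ffact leq_pmulr// fact_gt0.
Qed.

Lemma sum_bin_cvg f k : (forall m, 0 <= f m) -> fmoment f k \is a fin_num ->
  (\sum_(m < n.+1) f m * 'C(m, k)%:R) @[n --> \oo] --> (k`!)%:R^-1 * fine (fmoment f k).
Proof.
move=> f0 fk; have cv := fpart_cvg f0 fk.
have : (fun n => (k`!)%:R^-1 * fpart f k n) @ \oo --> (k`!)%:R^-1 * fine (fmoment f k).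
  by apply: cvgM => //; exact: cvg_cst.
rewrite -cvg_shiftS; apply: cvg_trans; apply: near_eq_cvg; near=> n; rewrite /fpart /= mulr_sumr.
apply: eq_bigr => m _; rewrite -bin_ffact natrM.
by field; rewrite pnatr_eq0 -lt0n fact_gt0.
Unshelve. all: by end_near.
Qed.

Lemma nu_plusE k (F : probability R R) :
  nu_plus k F = fmoment (fun m => mass F m%:Z) k.
Proof. by apply: eq_eseriesr => m _; rewrite massE. Qed.

Lemma nu_minusE k (F : probability R R) :
  nu_minus k F = fmoment (fun m => mass F (- m%:Z)) k.
Proof. by apply: eq_eseriesr => m _; rewrite massE mulrNz. Qed.

Lemma sum_mass_le1 (F : probability R R) (g : nat -> int) n : injective g ->
  \sum_(m < n) mass F (g m) <= 1.
Proof.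
move=> gi; rewrite -lee_fin -sumEFin -(probability_setT F).
pose s : seq R := [seq (g m)%:~R | m <- index_iota 0 n].
have us : uniq s by rewrite map_inj_uniq ?iota_uniq// => i j /intr_inj /gi.
apply: le_trans (sum_measure_set1_le F us).
rewrite big_map big_mkord.
by apply: lee_sum => m _; rewrite massE.
Qed.

End FactorialMoments.

(** * Matching moments under truncation *)

Section MomentMatching.
Context {R : realType}.
Implicit Types F G : probability R R.

Lemma cvgD0 (f g : nat -> R) : f K @[K --> \oo] --> (0 : R) ->
  g K @[K --> \oo] --> (0 : R) -> f K + g K @[K --> \oo] --> (0 : R).
Proof. by move=> f0 g0; have := cvgD f0 g0; rewrite addr0; exact. Qed.

Lemma cvgMl0 (a : R) (f : nat -> R) : f K @[K --> \oo] --> (0 : R) ->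
  a * f K @[K --> \oo] --> (0 : R).
Proof.
move=> f0; have a1 : (fun=> a) K @[K --> \oo] --> a by exact: cvg_cst.
by have := cvgM a1 f0; rewrite mulr0; exact.
Qed.

Lemma cvg_sum0 (I : Type) (r : seq I) (f : I -> nat -> R) :
  (forall i, f i K @[K --> \oo] --> (0 : R)) ->
  \sum_(i <- r) f i K @[K --> \oo] --> (0 : R).
Proof.
move=> f0; elim: r => [|i r ih].
  by under eq_fun do rewrite big_nil; exact: cvg_cst.
under eq_fun do rewrite big_cons.
exact: cvgD0.
Qed.

(** This is the bound on [E] in [lattice_expansion] for the difference of the masses. Equal moments
    need not stay equal after truncation, hence a defect for each K. *)
Definition moment_defect F G (s K : nat) : R :=
  `|l1 (lattice_poly K (mass F)) - l1 (lattice_poly K (mass G))| +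
  \sum_(k < s) 2 ^+ k.+1 *
    (`|\sum_(m < K.+1) mass F m%:Z * 'C(m, k.+1)%:R -
       \sum_(m < K.+1) mass G m%:Z * 'C(m, k.+1)%:R| +
     `|\sum_(m < K.+1) mass F (- m%:Z) * 'C(m, k.+1)%:R -
       \sum_(m < K.+1) mass G (- m%:Z) * 'C(m, k.+1)%:R|).

Definition beta k F G : \bar R := (beta_plus k F G + beta_minus k F G)%E.

Lemma nu_plus_ge0 k F : (0 <= nu_plus k F)%E.
Proof. by rewrite nu_plusE; apply: fmoment_ge0 => m; exact: mass_ge0. Qed.

Lemma nu_minus_ge0 k F : (0 <= nu_minus k F)%E.
Proof. by rewrite nu_minusE; apply: fmoment_ge0 => m; exact: mass_ge0. Qed.

Lemma beta_ge0 k F G : (0 <= beta k F G)%E.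
Proof. by rewrite /beta /beta_plus /beta_minus !adde_ge0 ?nu_plus_ge0 ?nu_minus_ge0. Qed.

Lemma beta_lty_fin_num k F G : (beta k F G < +oo)%E ->
  [/\ nu_plus k F \is a fin_num, nu_plus k G \is a fin_num,
      nu_minus k F \is a fin_num & nu_minus k G \is a fin_num].
Proof.
rewrite -ge0_fin_numE ?beta_ge0// /beta /beta_plus /beta_minus !fin_numD.
by move=> /andP[/andP[-> ->] /andP[-> ->]].
Qed.

Lemma lattice_poly_diff F G s K : (s <= K)%N -> (beta s.+1 F G < +oo)%E ->
  exists E V : {poly R},
  [/\ lattice_poly K (mass F) - lattice_poly K (mass G) = E + ('X - 1) ^+ s.+1 * V,
      l1 E <= moment_defect F G s K & l1 V <= fine (beta s.+1 F G)].
Proof.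
move=> sK bfin; pose c z := mass F z - mass G z.
have [E [V [EV lE lV]]] := lattice_expansion c sK.
exists E, V; split; first by rewrite lattice_polyB.
  rewrite (le_trans lE)// /moment_defect -big_lattice_split !l1_lattice_poly -sumrB.
  rewrite lerD2l; apply: ler_sum => k _; rewrite -!sumrB.
  rewrite le_eqVlt; apply/orP; left; apply/eqP.
  by congr (_ * (_ + _)); congr Num.norm; apply: eq_bigr => m _; rewrite -mulrBl.
have [fF fG mF mG] := beta_lty_fin_num bfin.
rewrite (le_trans lV)// /beta /beta_plus /beta_minus !fineD ?fin_numD ?fF ?fG ?mF ?mG//.
have cle z : `|c z| <= mass F z + mass G z.
  by rewrite (le_trans (ler_normB _ _))// !ger0_norm ?mass_ge0.
have split_le (g : nat -> int) : \sum_(m < K.+1) `|c (g m)| * 'C(m, s.+1)%:R <=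
    \sum_(m < K.+1) mass F (g m) * 'C(m, s.+1)%:R +
    \sum_(m < K.+1) mass G (g m) * 'C(m, s.+1)%:R.
  rewrite -big_split; apply: ler_sum => m _ /=.
  by rewrite -mulrDl ler_wpM2r.
apply: lerD.
  apply: le_trans (split_le (fun m => m%:Z)) _; rewrite !nu_plusE in fF fG *.
  by apply: lerD; apply: sum_bin_le_fmoment => // m; exact: mass_ge0.
apply: le_trans (split_le (fun m => - m%:Z)) _; rewrite !nu_minusE in mF mG *.
by apply: lerD; apply: (sum_bin_le_fmoment (f := fun m => mass _ (- m%:Z))) => // m;
   exact: mass_ge0.
Qed.

(** The truncated binomial moments of both laws tend to the same nu_k / k!, finite because the
    moments of order s + 1 are. *)
Lemma moment_defect_cvg F G s :
  F [set x | x \is a Num.int] = 1%E -> G [set x | x \is a Num.int] = 1%E ->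
  (beta s.+1 F G < +oo)%E ->
  (forall k, (1 <= k <= s)%N -> nu_plus k F = nu_plus k G) ->
  (forall k, (1 <= k <= s)%N -> nu_minus k F = nu_minus k G) ->
  moment_defect F G s K @[K --> \oo] --> (0 : R).
Proof.
move=> Fi Gi bfin hp hm; have [fF fG mF mG] := beta_lty_fin_num bfin.
have diff0 (f g : nat -> R) (l : R) : f K @[K --> \oo] --> l -> g K @[K --> \oo] --> l ->
    `|f K - g K| @[K --> \oo] --> (0 : R).
  by move=> fl gl; have := cvg_norm (cvgB fl gl); rewrite subrr normr0; exact.
apply: cvgD0.
  by apply: diff0; exact: l1_lattice_poly_cvg.
apply: cvg_sum0 => k.
have ks : (1 <= k.+1 <= s)%N by have := ltn_ord k.
have natZ_inj : injective (fun m : nat => m%:Z) by move=> i j [].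
have oppZ_inj : injective (fun m : nat => - m%:Z) by move=> i j /oppr_inj [].
apply: cvgMl0; apply: cvgD0.
  apply: (diff0 _ _ ((k.+1`!)%:R^-1 * fine (nu_plus k.+1 F))).
    rewrite nu_plusE; apply: sum_bin_cvg => [m|]; first exact: mass_ge0.
    by apply: fmoment_fin_num (_ : k.+1 <= s)%N _ => //; [move=> m; exact: mass_ge0|
       move=> n; exact: (sum_mass_le1 F n natZ_inj)|rewrite -nu_plusE].
  rewrite (hp _ ks) nu_plusE; apply: sum_bin_cvg => [m|]; first exact: mass_ge0.
  by apply: fmoment_fin_num (_ : k.+1 <= s)%N _ => //; [move=> m; exact: mass_ge0|
     move=> n; exact: (sum_mass_le1 G n natZ_inj)|rewrite -nu_plusE].
apply: (diff0 _ _ ((k.+1`!)%:R^-1 * fine (nu_minus k.+1 F))).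
  rewrite nu_minusE; apply: (sum_bin_cvg (f := fun m => mass F (- m%:Z))) => [m|].
    exact: mass_ge0.
  by apply: fmoment_fin_num (_ : k.+1 <= s)%N _ => //; [move=> m; exact: mass_ge0|
     move=> n; exact: (sum_mass_le1 F n oppZ_inj)|rewrite -nu_minusE].
rewrite (hm _ ks) nu_minusE; apply: (sum_bin_cvg (f := fun m => mass G (- m%:Z))) => [m|].
  exact: mass_ge0.
by apply: fmoment_fin_num (_ : k.+1 <= s)%N _ => //; [move=> m; exact: mass_ge0|
   move=> n; exact: (sum_mass_le1 G n oppZ_inj)|rewrite -nu_minusE].
Qed.

End MomentMatching.

(** * Grouping equal laws into powers *)

Section GroupedActs.
Context {R : rcfType}.

Lemma perm_enum_tagged (I : finType) (J : I -> finType) :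
  perm_eq (enum {: {i : I & J i}}) [seq Tagged J j | i <- enum I, j <- enum (J i)].
Proof.
apply: uniq_perm; first exact: enum_uniq.
  apply: allpairs_uniq_dep => [||[i j] [i' j'] _ _ //]; first exact: enum_uniq.
  by move=> i _; exact: enum_uniq.
move=> [i j]; rewrite mem_enum inE; apply/esym/allpairsPdep.
by exists i, j; rewrite !mem_enum.
Qed.

Lemma acts_tagged (N : nat) (n : 'I_N -> nat) (w : 'I_N -> R) (p : 'I_N -> {poly R})
    (h : R -> R) :
  acts [seq (w (tag k), p (tag k)) | k <- enum {: {i : 'I_N & 'I_(n i)}}] h =
  acts [seq (w i, p i ^+ n i) | i <- enum 'I_N] h.
Proof.
rewrite (acts_perm h (perm_map _ (perm_enum_tagged _))).
elim: (enum 'I_N) => //= i r ih; rewrite map_cat acts_cat ih.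
rewrite -map_comp (@eq_map _ _ _ (fun=> (w i, p i)))//.
have const_nseq (U V : Type) (c : V) (t : seq U) : [seq c | _ <- t] = nseq (size t) c.
  by elim: t => //= x t ->.
by rewrite const_nseq size_enum_ord acts_nseq.
Qed.

End GroupedActs.

(** * The difference of the distribution functions *)

Section CdfDifference.
Context {R : realType} {d : measure_display} {T : measurableType d}.
Variable P : probability T R.

Lemma grouped_cdf_approx (N : nat) (n : 'I_N -> nat) (w : 'I_N -> R)
    (F : 'I_N -> probability R R) (Y : {i : 'I_N & 'I_(n i)} -> {RV P >-> R})
    (K : nat) (x : R) (L : set T) :
  (forall k, integer_valued (Y k)) -> mutually_independent Y ->
  (forall k A, measurable A -> distribution P (Y k) A = F (tag k) A) ->
  measurable L -> L = [set t | \sum_k w (tag k) * Y k t <= x] ->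
  `|fine (P L) -
    acts [seq (w i, lattice_poly K (mass (F i)) ^+ n i) | i <- enum 'I_N]
      (halfline x) (- \sum_(k : {i : 'I_N & 'I_(n i)}) w (tag k) * K%:R)|
  <= fine (P (tail_event Y K)).
Proof.
move=> Yint Yind YF mL LE.
have := trunc_approx Yint Yind K mL LE.
rewrite (@eq_map _ _ _ (fun k => (w (tag k), lattice_poly K (mass (F (tag k)))))).
  by rewrite (acts_tagged n w (fun i => lattice_poly K (mass (F i)))).
move=> k; congr (_, lattice_poly _ _); apply/funext => z.
by congr fine; exact: YF.
Qed.

Lemma measurable_int : measurable [set x : R | x \is a Num.int].
Proof.
have -> : [set x : R | x \is a Num.int] = \bigcup_K lattice_points K.
  apply/seteqP; split => x /=.
    by move=> /intrP[z ->]; exists (absz z) => //; apply/lattice_pointsP; exists z => //; lia.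
  by move=> [K _ /lattice_pointsP[z -> _]]; rewrite intr_int.
by apply: bigcup_measurable => K _; apply: bigsetU_measurable.
Qed.

Lemma integer_valued_law (Y : {RV P >-> R}) (F : probability R R) :
  integer_valued Y -> (forall A, measurable A -> distribution P Y A = F A) ->
  F [set x | x \is a Num.int] = 1%E.
Proof.
move=> Yint YF; rewrite -(YF _ measurable_int) -(probability_setT P); congr (P _).
by apply/seteqP; split => t // _; exact: Yint.
Qed.

Lemma weighted_sum_cdfE (N : nat) (n : 'I_N -> nat) (w : 'I_N -> R)
    (X : forall i : 'I_N, 'I_(n i) -> {RV P >-> R}) (x : R) :
  weighted_sum w X @^-1` `]-oo, x] =
  [set t | \sum_(k : {i : 'I_N & 'I_(n i)}) w (tag k) * X (tag k) (tagged k) t <= x].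
Proof.
have sumE t : weighted_sum w X t =
    \sum_(k : {i : 'I_N & 'I_(n i)}) w (tag k) * X (tag k) (tagged k) t.
  by rewrite weighted_sumE; under eq_bigr do rewrite mulr_sumr; rewrite sig_big_dep.
by apply/seteqP; split => t /=; rewrite in_itv/= sumE.
Qed.

(** Truncate, apply [acts_swap], and let K tend to infinity. Half of each [u_of] is given up so that
    truncated overlaps are eventually large enough. *)
Lemma cdf_diff_le (N s : nat) (n : 'I_N -> nat) (w : 'I_N -> R)
    (F G : 'I_N -> probability R R)
    (X Z : forall i : 'I_N, 'I_(n i) -> {RV P >-> R}) (j0 : 'I_N) (x : R) :
  (forall i, (1 <= n i)%N) ->
  (forall i, 0 < w i) ->
  (forall i j, integer_valued (X i j)) ->
  (forall i j, integer_valued (Z i j)) ->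
  (forall i j A, measurable A -> distribution P (X i j) A = F i A) ->
  (forall i j A, measurable A -> distribution P (Z i j) A = G i A) ->
  mutually_independent (joint_family X Z) ->
  (forall i, 0 < u_of (F i) (G i)) ->
  (forall i k, (1 <= k <= s)%N -> nu_plus k (F i) = nu_plus k (G i)) ->
  (forall i k, (1 <= k <= s)%N -> nu_minus k (F i) = nu_minus k (G i)) ->
  (forall i, (beta s.+1 (F i) (G i) < +oo)%E) ->
  `|fine (P (weighted_sum w X @^-1` `]-oo, x])) -
    fine (P (weighted_sum w Z @^-1` `]-oo, x]))| <=
  \sum_i (n i)%:R * (fine (beta s.+1 (F i) (G i)) *
    rate s (n i) (u_of (F i) (G i) / 2) ^+ s *
    ((w i / w j0 + 1) * rate s (n j0) (u_of (F j0) (G j0) / 2))).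
Proof.
move=> n0 w0 Xi Zi XF ZG ind u0 hp hm bfin.
set u := fun i => u_of (F i) (G i).
pose X' := joint_family X Z \o inl; pose Z' := joint_family X Z \o inr.
have indX : mutually_independent X' by apply: mutually_independent_comp => // a b [].
have indZ : mutually_independent Z' by apply: mutually_independent_comp => // a b [].
have X'i k : integer_valued (X' k) by exact: Xi.
have Z'i k : integer_valued (Z' k) by exact: Zi.
(* As n i >= 1, some variable has law [F i], which is thus carried by the integers. *)
have Fint i : F i [set x | x \is a Num.int] = 1%E.
  exact: (integer_valued_law (Xi i (Ordinal (n0 i))) (XF i _)).
have Gint i : G i [set x | x \is a Num.int] = 1%E.
  exact: (integer_valued_law (Zi i (Ordinal (n0 i))) (ZG i _)).
have mS (Y : forall i : 'I_N, 'I_(n i) -> {RV P >-> R}) :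
    measurable (weighted_sum w Y @^-1` `]-oo, x]).
  by rewrite -[X in measurable X]setTI; apply: measurable_funPT.
pose c i := (w i / w j0 + 1) * rate s (n j0) (u j0 / 2).
have c0 i : 0 <= c i by rewrite mulr_ge0 ?rate_ge0// addr_ge0// divr_ge0// ltW.
pose rhs := \sum_i (n i)%:R * (fine (beta s.+1 (F i) (G i)) * rate s (n i) (u i / 2) ^+ s * c i).
(* Truncation is at [K.+1] because [overlap_lattice_poly] bounds the overlap at level K + 1 through
   the mass at level K. *)
pose err K := fine (P (tail_event X' K.+1)) + fine (P (tail_event Z' K.+1)) +
  \sum_i (n i)%:R * moment_defect (F i) (G i) s K.+1.
have err0 : err K @[K --> \oo] --> (0 : R).
  apply: cvgD0; first apply: cvgD0.
  - by rewrite (cvg_shiftS (fun K => fine (P (tail_event X' K)))); exact: tail_event_cvg.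
  - by rewrite (cvg_shiftS (fun K => fine (P (tail_event Z' K)))); exact: tail_event_cvg.
  - apply: cvg_sum0 => i; apply: cvgMl0.
    rewrite (cvg_shiftS (fun K => moment_defect (F i) (G i) s K)).
    by apply: moment_defect_cvg => //; [exact: hp|exact: hm].
(* Once the mass outside [-K, K] is at most u / 2, an overlap of u / 2 remains; induction over the
   finitely many indices makes K uniform. *)
have ov (H : 'I_N -> probability R R) : (forall i, H i [set x | x \is a Num.int] = 1%E) ->
    (forall i, u i <= 1 - 2^-1 * fine (tv_norm (shift_diff (H i)))) ->
    \forall K \near \oo, forall i, u i / 2 <= overlap (lattice_poly K.+1 (mass (H i))).
  move=> Hint uH.
  have : \forall K \near \oo, forall i, i \in enum 'I_N ->
      u i / 2 <= overlap (lattice_poly K.+1 (mass (H i))).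
    elim: (enum 'I_N) => [|i r ih]; first by near=> K.
    have : \forall K \near \oo, 1 - u i / 2 <= l1 (lattice_poly K (mass (H i))).
      apply: cvgr_ge (l1_lattice_poly_cvg (Hint i)) _ _.
      by rewrite ltrBlDr ltrDl divr_gt0// u0.
    move=> hi; near=> K => k; rewrite inE => /predU1P[->|]; last first.
      by move: k; near: K; exact: ih.
    have h1 : 1 - u i / 2 <= l1 (lattice_poly K (mass (H i))) by near: K.
    have := overlap_lattice_poly K (H i); have := uH i; lra.
  by apply: filterS => K h i; apply: h; rewrite mem_enum.
have uF i : u i <= 1 - 2^-1 * fine (tv_norm (shift_diff (F i))) by rewrite /u /u_of ge_min lexx.
have uG i : u i <= 1 - 2^-1 * fine (tv_norm (shift_diff (G i))) by rewrite /u /u_of ge_min lexx orbT.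
have ovF := ov F Fint uF; have ovG := ov G Gint uG.
have lim : err K + rhs @[K --> \oo] --> rhs.
  have rhs1 : (fun=> rhs) K @[K --> \oo] --> rhs by exact: cvg_cst.
  by have := cvgD err0 rhs1; rewrite add0r; exact.
have lhs1 (a : R) : (fun=> a) K @[K --> \oo] --> a by exact: cvg_cst.
(* The left side is independent of K, so a bound by [err K + rhs] for all large K suffices. *)
apply: (ler_cvg_to (lhs1 _) lim); near=> K.
have sK : (s <= K.+1)%N by apply: leqW; near: K; exact: nbhs_infty_ge.
have oF i : u i / 2 <= overlap (lattice_poly K.+1 (mass (F i))) by move: i; near: K.
have oG i : u i / 2 <= overlap (lattice_poly K.+1 (mass (G i))) by move: i; near: K.
have aX := @grouped_cdf_approx N n w F X' K.+1 x _ X'i indX (fun k => XF _ _) (mS X) (weighted_sum_cdfE w X x).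
have aZ := @grouped_cdf_approx N n w G Z' K.+1 x _ Z'i indZ (fun k => ZG _ _) (mS Z) (weighted_sum_cdfE w Z x).
have /choice[EV hEV] : forall i, exists EV : {poly R} * {poly R},
  [/\ lattice_poly K.+1 (mass (F i)) - lattice_poly K.+1 (mass (G i)) =
        EV.1 + ('X - 1) ^+ s.+1 * EV.2,
      l1 EV.1 <= moment_defect (F i) (G i) s K.+1 &
      l1 EV.2 <= fine (beta s.+1 (F i) (G i))].
  by move=> i; have [E [V h]] := lattice_poly_diff sK (bfin i); exists (E, V).
have half1 y : `|halfline x y| <= 1.
  by rewrite /halfline normr_nat; case: (y <= x) => /=.
have halfd : {homo halfline x : a b /~ a <= b}.
  move=> a b ab; rewrite /halfline ler_nat; case: (leP a x) => // ax.
  by rewrite (le_trans ab).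
have main := @acts_swap R N s w (fun i => lattice_poly K.+1 (mass (F i)))
  (fun i => lattice_poly K.+1 (mass (G i))) (fun i => (EV i).1) (fun i => (EV i).2)
  n (fun i => u i / 2) (halfline x) j0 w0 n0
  (fun i => lattice_poly_ge0 K.+1 (F i)) (fun i => lattice_poly_ge0 K.+1 (G i))
  (fun i => l1_lattice_poly_le1 K.+1 (F i)) (fun i => l1_lattice_poly_le1 K.+1 (G i))
  (fun i => divr_gt0 (u0 i) (ltr0Sn _ 1)) oF oG
  (fun i => let: And3 h _ _ := hEV i in h) half1 halfd
  (- \sum_(k : {i : 'I_N & 'I_(n i)}) w (tag k) * K.+1%:R).
have sumle : \sum_i (n i)%:R * (l1 (EV i).1 + l1 (EV i).2 * rate s (n i) (u i / 2) ^+ s * c i)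
    <= \sum_i (n i)%:R * moment_defect (F i) (G i) s K.+1 + rhs.
  rewrite -big_split; apply: ler_sum => i _ /=; have [_ hE hV] := hEV i.
  rewrite -mulrDr ler_wpM2l// lerD// ler_wpM2r// ler_wpM2r// exprn_ge0// rate_ge0//.
have {}main := le_trans main sumle.
move: aX aZ main; rewrite /err.
set a := acts _ _ _; set b := acts _ _ _.
set pX := fine (P (_ @^-1` _)); set pZ := fine (P (weighted_sum w Z @^-1` _)).
move=> aX aZ main.
have -> : pX - pZ = (pX - a) + (a - b) + (b - pZ) by ring.
rewrite (le_trans (ler_normD _ _))// (le_trans (lerD (ler_normD _ _) (lexx _)))//.
rewrite [`|b - _|]distrC; move: aX aZ main; lra.
Unshelve. all: by end_near.
Qed.

End CdfDifference.

(** * Explicit constants *)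

Section Constants.
Context {R : realType}.

Lemma rate_halfE (s n : nat) (u : R) : (0 < n)%N -> 0 < u ->
  rate s n (u / 2) = 4 * Num.sqrt s.+1%:R / Num.sqrt (n%:R * u).
Proof.
move=> n0 u0; rewrite /rate.
have nu0 : 0 < n%:R * u by rewrite mulr_gt0// ltr0n.
have -> : n%:R * (u / 2) / (2 * s.+1%:R) = (n%:R * u) * (4 * s.+1%:R)^-1.
  by field; rewrite addrC natr1 pnatr_eq0.
rewrite sqrtrM ?ltW// sqrtrV ?mulr_ge0// [Num.sqrt (4 * _)]sqrtrM//.
have -> : Num.sqrt 4 = 2 :> R.
  by rewrite (_ : 4 = 2 ^+ 2) ?sqrtr_sqr ?ger0_norm// expr2 -natrM.
by rewrite invfM invrK; ring.
Qed.

(** The factor n from the n telescoping terms lowers the exponent s / 2 of n to s / 2 - 1. *)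
Lemma powR_div_sqrt (s n : nat) (u : R) : (0 < n)%N -> 0 < u ->
  n%:R * ((Num.sqrt (n%:R * u))^-1) ^+ s =
  (n%:R `^ (s%:R / 2 - 1) * u `^ (s%:R / 2))^-1.
Proof.
move=> n0 u0; have n0' : 0 < n%:R :> R by rewrite ltr0n.
rewrite exprVn -powR12_sqrt ?mulr_ge0 ?ltW// -powR_mulrn ?powR_ge0// -powRrM.
rewrite powRM ?ltW// [2^-1 * _]mulrC powRB; last by apply/implyP => _; rewrite gt_eqF.
rewrite powRr1 ?ltW//.
have a0 : n%:R `^ (s%:R / 2) != 0 :> R by rewrite gt_eqF// powR_gt0.
have b0 : u `^ (s%:R / 2) != 0 by rewrite gt_eqF// powR_gt0.
by field; rewrite a0 b0 gt_eqF.
Qed.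

(** Take the largest term. Applied to the n_i u_i, it brings N into the constant. *)
Lemma exists_ge_mean (N : nat) (f : 'I_N -> R) : (0 < N)%N ->
  exists j, \sum_i f i <= N%:R * f j.
Proof.
move=> N0; pose i0 : 'I_N := Ordinal N0.
have [j _ jmax] := @arg_maxP _ _ 'I_N i0 predT f isT.
exists j; rewrite (@le_trans _ _ (\sum_(i < N) f j))//; last by rewrite sumr_const card_ord mulr_natl.
by apply: ler_sum => i _; exact: jmax.
Qed.

(** The summand 1 is absorbed because the maximal weight is at least the minimal one. *)
Lemma weight_ratio_le (N : nat) (w : 'I_N -> R) (i j : 'I_N) : (forall i, 0 < w i) ->
  w i / w j + 1 <= 2 * (max_weight w / min_weight w).
Proof.
move=> w0.
have maxi k : w k <= max_weight w by exact: le_bigmax.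
have mini k : min_weight w <= w k by exact: bigmin_le.
have min0 : 0 < min_weight w.
  by apply/bigmin_gtP; split => [|k _]; [exact: lt_le_trans (w0 i) (maxi i)|exact: w0].
have h1 : w i / w j <= max_weight w / min_weight w.
  by rewrite ler_pdivlMr// mulrAC ler_pdivrMr// ler_pM ?maxi ?mini// ltW.
have h2 : 1 <= max_weight w / min_weight w.
  by rewrite ler_pdivlMr// mul1r (le_trans (mini i)).
lra.
Qed.

End Constants.

(** * The bound in the Kolmogorov norm *)

Theorem theorem2p2 (R : realType) (N s : nat) (hN : (1 <= N)%N) (hs : (1 <= s)%N) :
  exists C : R, 0 < C /\
  forall (d : measure_display) (T : measurableType d) (P : probability T R)
    (n : 'I_N -> nat) (w : 'I_N -> R)
    (F G : 'I_N -> probability R R)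
    (X Z : forall i : 'I_N, 'I_(n i) -> {RV P >-> R}),
  (forall i, (1 <= n i)%N) ->
  (forall i, 0 < w i) ->
  (forall i j, integer_valued (X i j)) ->
  (forall i j, integer_valued (Z i j)) ->
  (forall i j A, measurable A -> distribution P (X i j) A = F i A) ->
  (forall i j A, measurable A -> distribution P (Z i j) A = G i A) ->
  mutually_independent (joint_family X Z) ->
  (forall i, 0 < u_of (F i) (G i)) ->
  (forall i, 1 <= (n i)%:R * u_of (F i) (G i)) ->
  (forall i k, (1 <= k <= s)%N -> nu_plus k (F i) = nu_plus k (G i)) ->
  (forall i k, (1 <= k <= s)%N -> nu_minus k (F i) = nu_minus k (G i)) ->
  (forall i,
    (beta_plus s.+1 (F i) (G i) + beta_minus s.+1 (F i) (G i) < +oo)%E) ->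
  (kolmogorov_norm
     (charge_sub (distribution P (weighted_sum w X))
                 (distribution P (weighted_sum w Z)))
   <= (C * (max_weight w / min_weight w)
         * (\sum_(i < N) (n i)%:R * u_of (F i) (G i)) `^ (- 2^-1))%:E
      * \sum_(i < N)
          ((beta_plus s.+1 (F i) (G i) + beta_minus s.+1 (F i) (G i))
           * (((n i)%:R `^ (s%:R / 2 - 1)
               * u_of (F i) (G i) `^ (s%:R / 2))^-1)%:E))%E.
Proof.
pose a : R := 4 * Num.sqrt s.+1%:R.
have a0 : 0 < a by rewrite mulr_gt0// sqrtr_gt0.
(* The s + 1 smoothing factors give a^(s+1), the comparison of shifts gives 2, and sqrt N comes from
   n_j0 u_j0 being at least the mean of the n_i u_i. *)
exists (2 * a ^+ s.+1 * Num.sqrt N%:R); split.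
  by rewrite !mulr_gt0 ?exprn_gt0 ?sqrtr_gt0 ?ltr0n.
move=> d T P n w F G X Z n0 w0 Xi Zi XF ZG ind u0 _ hp hm bfin.
set u := fun i => u_of (F i) (G i).
have nu0 i : 0 < (n i)%:R * u i by rewrite mulr_gt0 ?u0// ltr0n n0.
have [j0 hj0] := exists_ge_mean (fun i => (n i)%:R * u i) hN.
set U := \sum_(i < N) _ in hj0 *.
have U0 : 0 < U.
  rewrite /U (bigD1 j0)//= ltr_pwDl ?nu0//.
  by apply: sumr_ge0 => i _; exact: ltW.
pose b i := fine (beta s.+1 (F i) (G i)).
have bE i : (beta_plus s.+1 (F i) (G i) + beta_minus s.+1 (F i) (G i))%E = (b i)%:E.
  by rewrite /b fineK// ge0_fin_numE ?beta_ge0//; exact: bfin.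
have b0 i : 0 <= b i by rewrite fine_ge0// beta_ge0.
under eq_bigr do rewrite bE -EFinM.
rewrite sumEFin -EFinM; set rhs : R := (X in (_ <= X%:E)%E); apply: ge_ereal_sup => _ [x _ <-].
rewrite charge_subE.
change (`|P (weighted_sum w X @^-1` `]-oo, x]) - P (weighted_sum w Z @^-1` `]-oo, x])| <= rhs%:E)%E.
have mS (Y : forall i : 'I_N, 'I_(n i) -> {RV P >-> R}) :
    P (weighted_sum w Y @^-1` `]-oo, x]) \is a fin_num.
  by rewrite fin_num_measure// -[X in measurable X]setTI; apply: measurable_funPT.
rewrite -(fineK (mS X)) -(fineK (mS Z)) -EFinB abse_EFin lee_fin.
apply: le_trans (cdf_diff_le j0 x n0 w0 Xi Zi XF ZG ind u0 hp hm bfin) _.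
rewrite /rhs mulr_sumr; apply: ler_sum => i _; rewrite -/(b i) -/(u i) -/(u j0).
have sN0 : 0 < Num.sqrt N%:R :> R by rewrite sqrtr_gt0 ltr0n.
have sU0 : 0 < Num.sqrt U by rewrite sqrtr_gt0.
have rj : rate s (n j0) (u j0 / 2) <= a * Num.sqrt N%:R * U `^ (- 2^-1).
  rewrite rate_halfE ?n0 ?u0// -/a powRN powR12_sqrt ?(ltW U0)// -mulrA ler_pM2l//.
  rewrite ler_pdivlMr// mulrC ler_pdivrMr ?sqrtr_gt0// -sqrtrM ?ler0n//.
  by rewrite ler_wsqrtr.
have wr := weight_ratio_le i j0 w0.
rewrite (rate_halfE s (n0 i) (u0 i)) -/a -(powR_div_sqrt s (n0 i) (u0 i)) exprMn -/(u i).
set q := (Num.sqrt _)^-1 ^+ s; set ratio := max_weight w / min_weight w in wr *.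
have q0 : 0 <= q by rewrite exprn_ge0// invr_ge0 sqrtr_ge0.
have prod_le : (w i / w j0 + 1) * rate s (n j0) (u j0 / 2) <=
    (2 * ratio) * (a * Num.sqrt N%:R * U `^ (- 2^-1)).
  by rewrite ler_pM ?rate_ge0// addr_ge0// divr_ge0// ltW.
have coef0 : 0 <= (n i)%:R * b i * (a ^+ s * q) by rewrite !mulr_ge0// exprn_ge0// ltW.
have h := ler_wpM2l coef0 prod_le.
apply: (le_trans (le_trans _ h)); rewrite le_eqVlt ?[a ^+ s.+1]exprS;
  by apply/orP; left; apply/eqP; ring.
Qed.
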